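(* Let $d\ge2$ and let $\mathcal Q_l=(0,l_1)\times\cdots\times(0,l_{d-1})\times(0,1)\subset\mathbb R^d$ with $l_j>0$ and $l_j^2\notin\mathbb Q$ for at least one $1\le j\le d-1$. Fix any ball $B\subset\mathbb R^d$ and either Dirichlet or Neumann boundary conditions. Then the inverse localization property fails strongly on $\mathcal Q_l$, i.e. the set $$\mathcal N=\Big\{\varphi\in\mathrm{MW}^{\mathrm s}:\ \inf_{z^0\in\mathcal Q_l}\ \inf_{\lambda\in\Lambda}\ \inf_{u_\lambda\in\mathcal V^\lambda}\Big\|\varphi-u_\lambda\Big(z^0+\frac{\cdot}{\sqrt\lambda}\Big)\Big\|_{C^0(B)}>0\Big\}$$ is open and dense in $\mathrm{MW}^{\mathrm s}$.
   Context: $\mathrm{MW}=\{\varphi\in C^\infty(\mathbb R^d,\mathbb R):\Delta\varphi+\varphi=0\}$; $\mathrm{MW}^{\mathrm s}=\{f\in\mathrm{MW}:\ |z|^{(d-1)/2}f(z)\in L^\infty(\mathbb R^d)\}$, a Banach space with norm $\|f\|=\sup_z(1+|z|)^{(d-1)/2}|f(z)|$; openness and density refer to this norm. $\Lambda$ is the set of eigenvalues of $\Delta u+\lambda u=0$ in $\mathcal Q_l$ with the chosen boundary condition and $\mathcal V^\lambda$ the real eigenspace of $\lambda$ (eigenfunctions being products of sines, resp. cosines, hence defined on all of $\mathbb R^d$). *)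

(* Defs.v *)
From HB Require Import structures.
From mathcomp Require Import all_boot all_order all_algebra.
From mathcomp Require Import all_classical all_reals all_analysis.
Set Implicit Arguments. Unset Strict Implicit. Unset Printing Implicit Defensive.
Import Order.TTheory GRing.Theory Num.Theory.
Import numFieldNormedType.Exports.
Local Open Scope classical_set_scope.
Local Open Scope ring_scope.

Section Defs.
Variables (R : realType) (d : nat).
Notation V := 'rV[R]_d.

Definition evec (i : 'I_d) : V := delta_mx 0 i.

Definition enorm (z : V) : R := Num.sqrt (\sum_(i < d) z 0 i ^+ 2).

Fixpoint iterD (vs : seq V) (f : V -> R) : V -> R :=
  match vs with
  | [::] => f
  | v :: vs' => 'D_v (iterD vs' f)
  end.

Definition smooth (f : V -> R) : Prop :=
  forall vs : seq V, continuous (iterD vs f) /\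
    forall (x v : V), derivable (iterD vs f) x v.

Definition lap (f : V -> R) (x : V) : R :=
  \sum_(i < d) 'D_(evec i) ('D_(evec i) f) x.

Definition MW (f : V -> R) : Prop := smooth f /\ forall z, lap f z + f z = 0.

Definition wexp : R := (d%:R - 1) / 2.

Definition MWs (f : V -> R) : Prop :=
  MW f /\ exists C : R, forall z, (enorm z) `^ wexp * `|f z| <= C.

Definition wnorm (f : V -> R) : R :=
  sup (range (fun z => (1 + enorm z) `^ wexp * `|f z|)).

Definition side (l : 'I_d -> R) (i : 'I_d) : R :=
  if val i == d.-1 then 1 else l i.

Definition inQ (l : 'I_d -> R) (x : V) : Prop :=
  forall i, 0 < x 0 i < side l i.

Definition onFace (l : 'I_d -> R) (i : 'I_d) (x : V) : Prop :=
  (x 0 i = 0 \/ x 0 i = side l i) /\ forall j, 0 <= x 0 j <= side l j.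

Inductive BC := Dirichlet | Neumann.

(* V^lambda : real eigenfunctions (with 0) of Delta u + lambda u = 0 with the
   boundary condition on the faces of Q_l, as (analytic) functions on R^d *)
Definition eigsp (bc : BC) (l : 'I_d -> R) (lam : R) (u : V -> R) : Prop :=
  smooth u /\ (forall x, lap u x + lam * u x = 0) /\
  forall i x, onFace l i x ->
    match bc with
    | Dirichlet => u x = 0
    | Neumann => 'D_(evec i) u x = 0
    end.

Definition Lam (bc : BC) (l : 'I_d -> R) (lam : R) : Prop :=
  0 < lam /\ exists u, eigsp bc l lam u /\ u <> (fun _ => 0).

Definition eball (c : V) (r : R) : set V := [set x | enorm (x - c) < r].

Definition C0dist (B : set V) (phi : V -> R) (z0 : V) (lam : R) (u : V -> R) : R :=
  sup [set `|phi x - u (z0 + (Num.sqrt lam)^-1 *: x)| | x in B].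

Definition Nset (bc : BC) (l : 'I_d -> R) (B : set V) (phi : V -> R) : Prop :=
  MWs phi /\
  0 < inf [set r | exists z0 lam u,
             [/\ inQ l z0, Lam bc l lam, eigsp bc l lam u & r = C0dist B phi z0 lam u]].

End Defs.

(* Main.v *)
(** Pick a Q-linear functional q on the Q-span of the numbers 1/l_i^2 that kills
    1 (the last side has length 1) and sends some irrational 1/l_j^2 to 1, and put
    P = sum_i l_i^2 q(1/l_i^2) d_i^2.  Every product of sines or cosines occurring
    in an eigenfunction of eigenvalue pi^2 sum_i n_i^2/l_i^2 is an eigenfunction of
    P with eigenvalue -pi^2 q(sum_i n_i^2/l_i^2), which depends on the eigenvalue
    only.  So P u is a multiple of u for every eigenfunction u, and the same holds
    after localization: Pu(x) u(y) = Pu(y) u(x).  By interior estimates this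
    relation is stable under uniform limits on a ball, hence phi is in N as soon as
    it fails for phi at two points of the ball.  It does fail for a radial Bessel
    wave centred in the ball, because P is not a multiple of the Laplacian, and
    so it fails for arbitrarily small perturbations of any phi.

    That every eigenfunction is a finite sum of joint eigenfunctions of the d_i^2
    is proved without integration.  Solutions of the Helmholtz equation are
    analytic along coordinate lines, so the boundary conditions propagate to whole
    hyperplanes and u is even or odd across them, hence periodic and bounded on the
    whole space.  A discrete Fourier transform over translates u(x + k h e_i) with h
    small splits u into solutions f with f(x + h e_i) + f(x - h e_i) =
    2 cos(w h) f(x), and the gradient bound on bounded solutions forces
    d_i^2 f = -w^2 f. *)
Require Import Defs.
From HB Require Import structures.
From mathcomp Require Import all_boot all_order all_algebra.
From mathcomp Require Import all_classical all_reals all_analysis.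
From mathcomp Require Import ring lra.
Import Order.TTheory GRing.Theory Num.Theory.
Import numFieldNormedType.Exports.
Local Open Scope classical_set_scope.
Local Open Scope ring_scope.

Set Implicit Arguments. Unset Strict Implicit. Unset Printing Implicit Defensive.

(** * Directional derivatives *)
Section DerivativeRules.
Context {R : realType} {U V : normedModType R}.
Implicit Types (f g : U -> R) (x v : U).

(** The spaces [eigsp] are given by boundary conditions alone, so their trigonometric structure has
    to be earned; the only consequence kept is P u = -mu u. One eigenvalue may arise from many
    frequency vectors. The Q-linearity of q makes mu the same for all of them, and the irrationality
    of l_j^2 is what allows q(1) = 0 together with q(1/l_j^2) = 1: P then has weight zero in the
    last direction and nonzero weight in direction j. After localization the number mu/lambda stays
    unknown and changes with lambda, so there is no single equation P v = k v to pass to the limit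
    in. Comparing two points eliminates it: all localized eigenfunctions, for all lambda and z0,
    satisfy one and the same quadratic relation, and the infimum over this noncompact family is
    bounded below at once. Quadraticity also yields density: along phi + t psi the relation is a
    polynomial of degree two in t, led by the Wronskian of psi. The perturbation psi has to lie in
    MW^s, which is why the decay rate (d-1)/2 of the Bessel wave is proved, by an energy
    estimate. *)

Lemma is_derive_affine (f : V -> R) (A : U -> V) x v w :
  (forall h : R, A (h *: v + x) = h *: w + A x) -> derivable f (A x) w ->
  is_derive x v (fun y => f (A y)) ('D_w f (A x)).
Proof.
move=> Aw df.
have E : (fun h : R => h^-1 *: (((fun y => f (A y)) \o shift x) (h *: v) - f (A x)))
       = (fun h : R => h^-1 *: ((f \o shift (A x)) (h *: w) - f (A x))).
  by apply/funext => h /=; rewrite Aw.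
by apply: DeriveDef; [rewrite /derivable E|rewrite /derive E].
Qed.

Lemma is_derive_add f g x v (df dg : R) : is_derive x v f df ->
  is_derive x v g dg -> is_derive x v (fun y => f y + g y) (df + dg).
Proof. by move=> ? ?; exact: is_deriveD. Qed.

Lemma is_derive_sub f g x v (df dg : R) : is_derive x v f df ->
  is_derive x v g dg -> is_derive x v (fun y => f y - g y) (df - dg).
Proof. by move=> ? ?; exact: is_deriveB. Qed.

Lemma is_derive_mul f g x v (df dg : R) : is_derive x v f df ->
  is_derive x v g dg -> is_derive x v (fun y => f y * g y) (f x * dg + df * g x).
Proof. by move=> ? ?; rewrite [df * _]mulrC; exact: is_deriveM. Qed.

Lemma is_derive_scale f x v (k df : R) : is_derive x v f df ->
  is_derive x v (fun y => k * f y) (k * df).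
Proof. by move=> ?; exact: is_deriveZ. Qed.

Lemma is_derive_lin f g x v (a b df dg : R) : is_derive x v f df ->
  is_derive x v g dg -> is_derive x v (fun y => a * f y + b * g y) (a * df + b * dg).
Proof. by move=> ? ?; apply: is_derive_add; exact: is_derive_scale. Qed.

Lemma is_derive_const (k : R) x v : is_derive x v (fun _ => k) 0.
Proof. exact: is_derive_cst. Qed.

Lemma is_derive_unique f x v (a b : R) :
  is_derive x v f a -> is_derive x v f b -> a = b.
Proof. by move=> [_ <-] [_ <-]. Qed.

Lemma is_derive_bigsum {I : Type} (r : seq I) (f : I -> U -> R) (df : I -> R) x v :
  (forall i, is_derive x v (f i) (df i)) ->
  is_derive x v (fun y => \sum_(i <- r) f i y) (\sum_(i <- r) df i).
Proof.
move=> fdf; elim: r => [|i r IH].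
  under eq_fun do rewrite big_nil; rewrite big_nil; exact: is_derive_const.
by under eq_fun do rewrite big_cons; rewrite big_cons; exact: is_derive_add.
Qed.

End DerivativeRules.

Section ContinuousRules.
Context {R : realType} {T : topologicalType}.
Implicit Types f g : T -> R.

Lemma continuous_fcst (k : R) : continuous (fun _ : T => k).
Proof. by move=> x; exact: cvg_cst. Qed.

Lemma continuous_fadd f g : continuous f -> continuous g ->
  continuous (fun x => f x + g x).
Proof. by move=> cf cg x; exact: (cvgD (cf x) (cg x)). Qed.

Lemma continuous_fsub f g : continuous f -> continuous g ->
  continuous (fun x => f x - g x).
Proof. by move=> cf cg x; exact: (cvgB (cf x) (cg x)). Qed.

Lemma continuous_fmul f g : continuous f -> continuous g ->
  continuous (fun x => f x * g x).
Proof. by move=> cf cg x; exact: (cvgM (cf x) (cg x)). Qed.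

End ContinuousRules.

Arguments continuous_fcst {R T} k.
Arguments continuous_fadd {R T} [f g] _ _.
Arguments continuous_fsub {R T} [f g] _ _.
Arguments continuous_fmul {R T} [f g] _ _.

Section OneVariable.
Context {R : realType}.
Implicit Types (f g df dg : R -> R).

(** Derivability is only directional here, without a total differential; restricting f to the line h
    v + x reduces the claim to the scalar chain rule at h = 0. *)
Lemma is_derive_chain {U : normedModType R} (f : U -> R) g (x v : U) (df dg : R) :
  is_derive (f x) 1 g dg -> is_derive x v f df ->
  is_derive x v (fun y => g (f y)) (dg * df).
Proof.
move=> gd [fd fv].
pose F := fun h : R => f (h *: v + x).
have Fd : is_derive (0 : R) 1 F df.
  rewrite -fv; have := @is_derive_affine R R^o U f (fun h : R => h *: v + x) 0 1 v.
  rewrite /= scale0r add0r; apply=> //.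
  by move=> h; rewrite addr0 [h *: 1]mulr1.
have gd' : is_derive (F 0) 1 g dg by rewrite /F scale0r add0r.
have := @is_derive1_comp R g F 0 dg df gd' Fd.
set G := g \o F => Gd.
have E : (fun h : R => h^-1 *: (((fun y => g (f y)) \o shift x) (h *: v) - g (f x)))
       = (fun h : R => h^-1 *: ((G \o shift 0) (h *: 1) - G 0)).
  by apply/funext => h /=; rewrite /G /F /= addr0 [_ *: 1]mulr1 scale0r add0r.
by case: Gd => Gd Gv; apply: DeriveDef; [rewrite /derivable E|rewrite /derive E -Gv].
Qed.

Lemma derivable_continuous g : (forall x : R, derivable g x 1) -> continuous g.
Proof. by move=> dg x; apply/differentiable_continuous/derivable1_diffP. Qed.

Lemma is_derive_continuous g dg : (forall x : R, is_derive x 1 g (dg x)) -> continuous g.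
Proof. by move=> dgP; apply: derivable_continuous => x; case: (dgP x). Qed.

Lemma mvt_itv g dg (a b : R) : a < b -> (forall x : R, is_derive x 1 g (dg x)) ->
  exists c, [/\ a < c, c < b & g b - g a = dg c * (b - a)].
Proof.
move=> ab gd; have [|c cab E] := @MVT R g dg a b ab (fun x _ => gd x).
  by apply: continuous_subspaceT; exact: is_derive_continuous gd.
by exists c; split; rewrite ?(itvP cab).
Qed.

End OneVariable.

(* Locked, because unifying two directional derivatives by unfolding them down to
   limits is prohibitively slow. *)
HB.lock Definition dirD {R : realType} {d : nat} (v : 'rV[R]_d) (f : 'rV[R]_d -> R) :
  'rV[R]_d -> R := fun x => 'D_v f x.

(** * Smooth functions and symmetry of mixed derivatives *)

Section Smooth.
Context {R : realType} {d : nat}.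
Notation V := 'rV[R]_d.
Implicit Types (f g : V -> R) (x v w : V).

(** Coinduction principle for [smooth]: it suffices to exhibit a class of continuous, derivable
    functions stable under every [dirD v]. Each closure property below amounts to choosing such a
    class. *)
Lemma smooth_coind (S : (V -> R) -> Prop) :
  (forall f, S f -> [/\ continuous f, forall x v, derivable f x v &
                      forall v, S (dirD v f)]) ->
  forall f, S f -> smooth f.
Proof.
move=> SP f Sf vs; suff : S (Defs.iterD vs f) by move=> /SP[].
elim: vs => [//|v vs IH] /=; have [_ _ /(_ v)] := SP _ IH.
by rewrite dirD.unlock.
Qed.

Lemma smooth_continuous f : smooth f -> continuous f.
Proof. by move=> /(_ [::])[]. Qed.
Arguments smooth_continuous [f] _.

Lemma smooth_derivable f x v : smooth f -> derivable f x v.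
Proof. by move=> /(_ [::])[_]; apply. Qed.
Arguments smooth_derivable [f] x v _.

Lemma smooth_is_derive f x v : smooth f -> is_derive x v f (dirD v f x).
Proof. by move=> sf; rewrite dirD.unlock; apply/derivableP/smooth_derivable. Qed.

Lemma derivable_dirD f x v : derivable f x v -> is_derive x v f (dirD v f x).
Proof. by rewrite dirD.unlock; exact: derivableP. Qed.

Lemma dirD_val f x v (df : R) : is_derive x v f df -> dirD v f x = df.
Proof. by rewrite dirD.unlock; case. Qed.

Lemma smooth_dirD f v : smooth f -> smooth (dirD v f).
Proof.
move=> sf vs; have := sf (rcons vs v).
rewrite dirD.unlock.
suff -> : Defs.iterD (rcons vs v) f = Defs.iterD vs ('D_v f) by [].
by elim: vs => //= w vs ->.
Qed.

Lemma dirD_lin f g (a b : R) v x : smooth f -> smooth g ->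
  dirD v (fun x => a * f x + b * g x) x = a * dirD v f x + b * dirD v g x.
Proof.
by move=> sf sg; apply: dirD_val; apply: is_derive_lin; exact: smooth_is_derive.
Qed.

Lemma smooth_lin f g (a b : R) : smooth f -> smooth g ->
  smooth (fun x => a * f x + b * g x).
Proof.
move=> sf sg.
apply: (@smooth_coind (fun h => exists f g, [/\ smooth f, smooth g &
   h = fun x => a * f x + b * g x])); last by exists f, g.
move=> {f g sf sg} h [f [g [sf sg ->]]]; split.
- exact: (continuous_fadd (continuous_fmul (continuous_fcst a) (smooth_continuous sf))
      (continuous_fmul (continuous_fcst b) (smooth_continuous sg))).
- by move=> x v; case: (is_derive_lin a b (smooth_is_derive x v sf) (smooth_is_derive x v sg)).
- move=> v; exists (dirD v f), (dirD v g).
  split; [exact: smooth_dirD|exact: smooth_dirD|].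
  by apply/funext => x; exact: dirD_lin.
Qed.

Definition affine_map (A B : V -> V) :=
  continuous A /\ forall x v (h : R), A (h *: v + x) = h *: B v + A x.

Lemma dirD_affine f A B v x : smooth f -> affine_map A B ->
  dirD v (fun x => f (A x)) x = dirD (B v) f (A x).
Proof.
move=> sf [_ AB]; apply: dirD_val; rewrite dirD.unlock; apply: is_derive_affine => //.
exact: smooth_derivable.
Qed.

Lemma smooth_affine f A B : smooth f -> affine_map A B ->
  smooth (fun x => f (A x)).
Proof.
move=> sf AB.
apply: (@smooth_coind (fun h => exists2 f, smooth f & h = fun x => f (A x)));
  last by exists f.
move=> {f sf} h [f sf ->]; split.
- move=> x; apply: continuous_comp; [exact: AB.1|exact: smooth_continuous].
- move=> x v; have [cA E] := AB.
  by case: (is_derive_affine (E x v) (smooth_derivable _ _ sf)).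
- move=> v; exists (dirD (B v) f); first exact: smooth_dirD.
  by apply/funext => x; exact: dirD_affine.
Qed.

Lemma is_derive_line f x v (t : R) : smooth f ->
  is_derive t 1 (fun s : R => f (x + s *: v)) (dirD v f (x + t *: v)).
Proof.
move=> sf; rewrite dirD.unlock.
apply: (@is_derive_affine R R^o _ f (fun h : R => x + h *: v) t 1 v) => /=.
  by move=> h; rewrite [h *: 1]mulr1 scalerDl addrCA.
exact: smooth_derivable.
Qed.

Lemma dirD_scalev f x v (c : R) : smooth f -> dirD (c *: v) f x = c * dirD v f x.
Proof.
move=> sf.
have d1 := is_derive_line x (c *: v) 0 sf.
have d2 := is_derive_line x v (c * 0) sf.
have dc : is_derive (0 : R) 1 (fun h : R => c * h) (c * 1).
  by apply: is_derive_scale; exact: is_derive_id.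
have := @is_derive1_comp R (fun s => f (x + s *: v)) (fun h => c * h) 0 _ _ d2 dc.
have -> : (fun s => f (x + s *: v)) \o *%R c = (fun s : R => f (x + s *: (c *: v))).
  by apply/funext => s /=; rewrite scalerA mulrC.
move=> d3; have := is_derive_unique d1 d3.
by rewrite mulr0 !scale0r !addr0 mulr1 mulrC.
Qed.

Lemma mvt_line f x v (s : R) : smooth f -> 0 < s ->
  exists t, [/\ 0 < t, t < s & f (x + s *: v) - f x = dirD v f (x + t *: v) * s].
Proof.
move=> sf s0; have [t [t0 ts E]] := mvt_itv s0 (fun t => is_derive_line x v t sf).
by exists t; split => //; rewrite -[in RHS](subr0 s) -E scale0r addr0.
Qed.

Lemma continuous_near (g : V -> R) x (e : R) : continuous g -> 0 < e ->
  exists2 r : R, 0 < r & forall y, `|y - x| < r -> `|g y - g x| < e.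
Proof.
move=> cg e0; have /cvgrPdist_lt/(_ e e0) := cg x.
move=> /nbhs_ballP[r r0 rP]; exists r => // y yx.
by rewrite distrC; apply: rP; rewrite -ball_normE/= distrC.
Qed.

Lemma affine_shift w : affine_map (fun y => y + w) id.
Proof.
split; last by move=> y u h; rewrite addrA.
by move=> y; exact: (cvgD cvg_id (cvg_cst _)).
Qed.

(** The mean value theorem is used twice: along v for the increment f(. + s w) - f, then along w for
    the derivative [dirD v f]. *)
Lemma double_difference f x v w (s : R) : smooth f -> 0 < s ->
  exists a b, [/\ 0 < a < s, 0 < b < s &
   f (x + s *: v + s *: w) - f (x + s *: v) - f (x + s *: w) + f x =
   dirD w (dirD v f) (x + a *: v + b *: w) * s ^+ 2].
Proof.
move=> sf s0.
have tr := affine_shift (s *: w).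
have sfw := smooth_affine sf tr.
have [a [a0 as_ E]] := mvt_line x v (smooth_lin 1 (-1) sfw sf) s0.
have [b [b0 bs E2]] := mvt_line (x + a *: v) w (smooth_dirD v sf) s0.
exists a, b; split; rewrite ?a0 ?b0//.
move: E; rewrite (dirD_lin 1 (-1) _ _ sfw sf) (dirD_affine _ _ sf tr) !mul1r !mulN1r E2 => E.
by rewrite expr2 mulrA -E; ring.
Qed.

(* Both mixed derivatives are limits of the same double difference quotient. *)
Lemma dirD_comm f v w x : smooth f -> dirD v (dirD w f) x = dirD w (dirD v f) x.
Proof.
move=> sf; apply/eqP; rewrite -subr_eq0; apply/negPn/negP => ne.
set A := dirD v (dirD w f) x; set B := dirD w (dirD v f) x.
have e0 : 0 < `|A - B| / 2 by rewrite divr_gt0// normr_gt0.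
have cA := smooth_continuous (smooth_dirD v (smooth_dirD w sf)).
have cB := smooth_continuous (smooth_dirD w (smooth_dirD v sf)).
have [r1 r10 h1] := continuous_near x cA e0.
have [r2 r20 h2] := continuous_near x cB e0.
pose m := Num.min r1 r2; have m0 : 0 < m by rewrite lt_min r10 r20.
pose K := `|v| + `|w| + 1.
have K0 : 0 < K by rewrite ltr_wpDl// addr_ge0.
pose s := m / K; have s0 : 0 < s by rewrite divr_gt0.
have small a b : 0 < a < s -> 0 < b < s -> `|a *: v + b *: w| < m.
  move=> /andP[a0 as_] /andP[b0 bs]; apply: le_lt_trans (ler_normD _ _) _.
  rewrite !normrZ !gtr0_norm//.
  apply: (@le_lt_trans _ _ (s * `|v| + s * `|w|)).
    by apply: lerD; rewrite ler_wpM2r// ltW.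
  by rewrite -mulrDr /s mulrAC ltr_pdivrMr// ltr_pM2l// ltrDl.
have [a [b [ab bb E]]] := double_difference x v w sf s0.
have [b' [a' [ab' bb' E']]] := double_difference x w v sf s0.
have EE : dirD w (dirD v f) (x + a *: v + b *: w) = dirD v (dirD w f) (x + b' *: w + a' *: v).
  have E2 : dirD w (dirD v f) (x + a *: v + b *: w) * s ^+ 2 =
            dirD v (dirD w f) (x + b' *: w + a' *: v) * s ^+ 2.
    refine (etrans (esym E) (etrans _ E')).
    have -> : x + s *: v + s *: w = x + s *: w + s *: v by rewrite addrAC.
    move: (f _) (f _) (f _) (f _) => p q t u.
    by congr (_ + _); rewrite addrAC.
  by apply: mulIf E2; rewrite expf_neq0// gt_eqF.
have k2 : `|dirD w (dirD v f) (x + a *: v + b *: w) - B| < `|A - B| / 2.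
  apply: h2; rewrite -(addrA x) [x + _ - x]addrC addKr.
  by apply: lt_le_trans (small _ _ ab bb) _; rewrite ge_min lexx orbT.
have k1 : `|dirD v (dirD w f) (x + b' *: w + a' *: v) - A| < `|A - B| / 2.
  apply: h1; rewrite -(addrA x) [x + _ - x]addrC addKr [b' *: w + _]addrC.
  by apply: lt_le_trans (small _ _ bb' ab') _; rewrite ge_min lexx.
rewrite EE in k2; rewrite distrC in k1.
have := ltrD k1 k2; rewrite -splitr ltNge => /negP; apply; exact: ler_distD.
Qed.

End Smooth.
Arguments smooth_continuous {R d} [f] _.
Arguments smooth_derivable {R d} [f] x v _.

(** * The Helmholtz equation *)
Section SmoothProducts.
Context {R : realType} {d : nat}.
Notation V := 'rV[R]_d.
Implicit Types (f g k : V -> R) (x v w : V).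

Lemma smooth_const (c : R) : smooth (fun _ : V => c).
Proof.
apply: (@smooth_coind _ _ (fun h => exists c, h = fun _ => c)); last by exists c.
move=> _ [{}c ->]; split; first exact: continuous_fcst.
- by move=> x v; case: (is_derive_const c x v).
- by move=> v; exists 0; apply/funext => x; apply: dirD_val; exact: is_derive_const.
Qed.

Lemma smooth_add f g : smooth f -> smooth g -> smooth (fun x => f x + g x).
Proof.
move=> sf sg; have := smooth_lin 1 1 sf sg.
by congr smooth; apply/funext => x; rewrite !mul1r.
Qed.

Lemma smooth_sum {I : Type} (r : seq I) (f : I -> V -> R) :
  (forall i : I, smooth (f i)) -> smooth (fun x => \sum_(i <- r) f i x).
Proof.
move=> sf; elim: r => [|i r IH].
  by under eq_fun do rewrite big_nil; exact: smooth_const.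
under eq_fun do rewrite big_cons; exact: smooth_add (sf i) IH.
Qed.

Lemma is_derive_coord (i : 'I_d) x v : is_derive x v (fun y : V => y 0 i) (v 0 i).
Proof.
have <- : 'D_(v 0 i) (@id R) (x 0 i) = v 0 i by rewrite derive_id.
apply: (@is_derive_affine R V R^o id (fun y : V => y 0 i)).
  by move=> h; rewrite !mxE.
exact: derivable_id.
Qed.

Lemma continuous_coord (i : 'I_d) : continuous (fun y : V => y 0 i).
Proof. exact: coord_continuous. Qed.

Lemma dirD_coord (i : 'I_d) x v : dirD v (fun y => y 0 i) x = v 0 i.
Proof. by apply: dirD_val; exact: is_derive_coord. Qed.

Lemma smooth_coord (i : 'I_d) : smooth (fun y : V => y 0 i).
Proof.
apply: (@smooth_coind _ _ (fun h => h = (fun y => y 0 i) \/ smooth h)); last by left.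
move=> h [->|sh]; split.
- exact: continuous_coord.
- by move=> x v; case: (is_derive_coord i x v).
- move=> v; right; rewrite (_ : dirD v _ = fun=> v 0 i); first exact: smooth_const.
  by apply/funext => x; exact: dirD_coord.
- exact: smooth_continuous.
- by move=> x v; exact: smooth_derivable.
- by move=> v; right; exact: smooth_dirD.
Qed.

(** By the Leibniz rule, derivatives of a product are sums of products; this is the smallest class
    of that kind that [smooth_coind] accepts. *)
Inductive prod_sum : (V -> R) -> Prop :=
| prod_sum_mul f g : smooth f -> smooth g -> prod_sum (fun x => f x * g x)
| prod_sum_add f g : prod_sum f -> prod_sum g -> prod_sum (fun x => f x + g x).

Lemma is_derive_prod f g x v : smooth f -> smooth g ->
  is_derive x v (fun x => f x * g x) (f x * dirD v g x + dirD v f x * g x).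
Proof. by move=> sf sg; apply: is_derive_mul; exact: smooth_is_derive. Qed.

Lemma smooth_mul f g : smooth f -> smooth g -> smooth (fun x => f x * g x).
Proof.
move=> sf sg; apply: (@smooth_coind _ _ prod_sum); last exact: prod_sum_mul.
move=> h; elim=> [{sf sg}f1 g1 sf sg|f1 g1 _ [cf df Df] _ [cg dg Dg]]; split.
- exact: (continuous_fmul (smooth_continuous sf) (smooth_continuous sg)).
- by move=> x v; case: (is_derive_prod x v sf sg).
- move=> v; rewrite (_ : dirD v _ = fun x => f1 x * dirD v g1 x + dirD v f1 x * g1 x).
    exact: prod_sum_add (prod_sum_mul sf (smooth_dirD v sg))
      (prod_sum_mul (smooth_dirD v sf) sg).
  by apply/funext => x; apply: dirD_val; exact: is_derive_prod.
- exact: (continuous_fadd cf cg).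
- by move=> x v; exact: derivableD.
- move=> v; rewrite (_ : dirD v _ = fun x => dirD v f1 x + dirD v g1 x).
    exact: prod_sum_add.
  by apply/funext => x; apply: dirD_val; apply: is_derive_add; exact: derivable_dirD.
Qed.

Section Composition.
Variable G : (R -> R) -> Prop.
Hypothesis G_derive : forall g : R -> R, G g ->
  exists2 g', G g' & forall t : R, is_derive t 1 g (g' t).

(** The invariant for g(f): by the chain rule its derivatives are sums of terms g'(f) k with g' in
    the derivation-stable class [G] and k smooth. [G] will be the multiples of Bessel functions, and
    later the trigonometric functions. *)
Inductive comp_sum f : (V -> R) -> Prop :=
| comp_sum_mul (g : R -> R) k : G g -> smooth k -> comp_sum f (fun x => g (f x) * k x)
| comp_sum_add h k : comp_sum f h -> comp_sum f k -> comp_sum f (fun x => h x + k x).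

Lemma smooth_comp f (g : R -> R) : smooth f -> G g -> smooth (fun x => g (f x)).
Proof.
move=> sf Gg; apply: (@smooth_coind _ _ (comp_sum f)); last first.
  rewrite (_ : (fun x => g (f x)) = (fun x => g (f x) * 1)).
    by apply: comp_sum_mul => //; exact: smooth_const.
  by apply/funext => x; rewrite mulr1.
move=> h; elim=> [{Gg}g1 k Gg sk|f1 g1 _ [cf df Df] _ [cg dg Dg]].
- have [g' Gg' dg] := G_derive Gg.
  have Dk x v : is_derive x v (fun x => g1 (f x) * k x)
     (g1 (f x) * dirD v k x + (g' (f x) * dirD v f x) * k x).
    apply: is_derive_mul; last exact: smooth_is_derive.
    by apply: is_derive_chain; exact: smooth_is_derive.
  split.
  + have cg := is_derive_continuous dg.
    apply: continuous_fmul (smooth_continuous sk) => x.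
    by apply: continuous_comp; [exact: smooth_continuous|exact: cg].
  + by move=> x v; case: (Dk x v).
  + move=> v; rewrite (_ : dirD v _ = fun x => g1 (f x) * dirD v k x +
                               g' (f x) * (dirD v f x * k x)).
      exact: comp_sum_add (comp_sum_mul f Gg (smooth_dirD v sk))
        (comp_sum_mul f Gg' (smooth_mul (smooth_dirD v sf) sk)).
    by apply/funext => x; rewrite mulrA; exact: dirD_val.
- split.
  + exact: (continuous_fadd cf cg).
  + by move=> x v; exact: derivableD.
  + move=> v; rewrite (_ : dirD v _ = fun x => dirD v f1 x + dirD v g1 x).
      exact: comp_sum_add.
    by apply/funext => x; apply: dirD_val; apply: is_derive_add; exact: derivable_dirD.
Qed.

End Composition.
End SmoothProducts.

(** * Solutions of the Helmholtz equation and their symmetries *)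

Section Helmholtz.
Context {R : realType} {d : nat}.
Notation V := 'rV[R]_d.
Notation e := (@evec R d).
Implicit Types (f g : V -> R) (x v w : V) (i j : 'I_d) (lam : R).

Lemma lapE f x : lap f x = \sum_(i < d) dirD (e i) (dirD (e i) f) x.
Proof. by rewrite dirD.unlock. Qed.

Lemma evecE i j : e i 0 j = (i == j)%:R.
Proof. by rewrite /evec mxE eqxx /= eq_sym. Qed.

Lemma lap_lin f g (a b : R) x : smooth f -> smooth g ->
  lap (fun x => a * f x + b * g x) x = a * lap f x + b * lap g x.
Proof.
move=> sf sg; rewrite !lapE !big_distrr -big_split /=; apply: eq_bigr => i _.
have Df : dirD (e i) (fun x => a * f x + b * g x) =
    fun x => a * dirD (e i) f x + b * dirD (e i) g x.
  by apply/funext => y; exact: dirD_lin.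
by rewrite Df (dirD_lin a b _ _ (smooth_dirD (e i) sf) (smooth_dirD (e i) sg)).
Qed.

Definition helm lam f := smooth f /\ forall x, lap f x + lam * f x = 0.

Lemma helm_lin lam f g (a b : R) : helm lam f -> helm lam g ->
  helm lam (fun x => a * f x + b * g x).
Proof.
move=> [sf Hf] [sg Hg]; split; first exact: smooth_lin.
move=> x; rewrite lap_lin//.
have {}Hf := addr0_eq (Hf x); have {}Hg := addr0_eq (Hg x).
rewrite -[lap f x]opprK Hf -[lap g x]opprK Hg.
by move: (f x) (g x) => p q; ring.
Qed.

Lemma helm_scale lam f c : helm lam f -> helm lam (fun x => c * f x).
Proof.
move=> Hf; have := helm_lin c 0 Hf Hf; congr helm.
by apply/funext => x; rewrite mul0r addr0.
Qed.

Lemma helm_add lam f g : helm lam f -> helm lam g -> helm lam (fun x => f x + g x).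
Proof.
move=> Hf Hg; have := helm_lin 1 1 Hf Hg; congr helm.
by apply/funext => x; rewrite !mul1r.
Qed.

Lemma helm_sub lam f g : helm lam f -> helm lam g -> helm lam (fun x => f x - g x).
Proof.
move=> Hf Hg; have := helm_lin 1 (-1) Hf Hg; congr helm.
by apply/funext => x; rewrite mul1r mulN1r.
Qed.

Lemma helm0 lam : helm lam (fun _ => 0).
Proof.
split; first exact: smooth_const.
move=> x; have := lap_lin 0 0 x (@smooth_const R d 0) (@smooth_const R d 0).
by rewrite !mul0r addr0 mulr0 addr0 => ->.
Qed.

Lemma helm_sum lam {I : Type} (r : seq I) (f : I -> V -> R) :
  (forall i : I, helm lam (f i)) -> helm lam (fun x => \sum_(i <- r) f i x).
Proof.
move=> Hf; elim: r => [|i r IH].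
  by under eq_fun do rewrite big_nil; exact: helm0.
by under eq_fun do rewrite big_cons; exact: helm_add.
Qed.

(** A linear part that is diagonal with entries of equal square [c2] multiplies the Laplacian by
    [c2]. This covers translations (c = 1), coordinate reflections (c = 1 or -1) and dilations (c =
    s) at once. *)
Lemma helm_affine lam f (A B : V -> V) (c : 'I_d -> R) (c2 : R) :
  helm lam f -> affine_map A B -> (forall i, B (e i) = c i *: e i) ->
  (forall i, c i ^+ 2 = c2) -> helm (c2 * lam) (fun x => f (A x)).
Proof.
move=> [sf Hf] AB Be cc; split; first exact: smooth_affine sf AB.
move=> x; rewrite lapE.
have E i : dirD (e i) (dirD (e i) (fun x => f (A x))) x =
           c2 * dirD (e i) (dirD (e i) f) (A x).
  have -> : dirD (e i) (fun x => f (A x)) = fun x => c i * dirD (e i) f (A x).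
    by apply/funext => y; rewrite (dirD_affine _ _ sf AB) Be dirD_scalev.
  have s1 := smooth_dirD (e i) sf.
  have s2 := smooth_affine s1 AB.
  transitivity (c i * dirD (e i) (fun x => dirD (e i) f (A x)) x).
    by apply: dirD_val; apply: is_derive_scale; exact: smooth_is_derive.
  by rewrite (dirD_affine _ _ s1 AB) Be dirD_scalev// mulrA -expr2 cc.
by rewrite (eq_bigr _ (fun i _ => E i)) -big_distrr /= -lapE -mulrA -mulrDr Hf mulr0.
Qed.

Lemma helm_shift lam f w : helm lam f -> helm lam (fun x => f (x + w)).
Proof.
move=> Hf; have := helm_affine (c := fun=> 1) (c2 := 1) Hf (affine_shift w).
by rewrite mul1r; apply=> i; rewrite ?scale1r ?expr1n.
Qed.

Definition mirror i (a : R) x : V := x + (2 * (a - x 0 i)) *: e i.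

Lemma affine_mirror i a : affine_map (mirror i a) (fun v => v - (2 * v 0 i) *: e i).
Proof.
split.
  have c : continuous (fun x : V => 2 * (a - x 0 i)).
    exact: (continuous_fmul (continuous_fcst 2)
      (continuous_fsub (continuous_fcst a) (@continuous_coord R d i))).
  have c1 : continuous (fun x : V => (2 * (a - x 0 i)) *: e i).
    move=> x; apply: (@continuous_comp V _ _ (fun x : V => 2 * (a - x 0 i))
      (fun t => t *: e i)); first exact: c.
    exact: scalel_continuous.
  by move=> x; exact: (cvgD cvg_id (c1 x)).
move=> x v h; rewrite /mirror; apply/rowP => j; rewrite !mxE.
by ring.
Qed.

Lemma mirror_evec i j : e j - (2 * e j 0 i) *: e i = (-1) ^+ (i == j) *: e j.
Proof.
rewrite evecE [j == i]eq_sym; case: eqVneq => [<-|ne].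
  by rewrite expr1 -[X in X - _]scale1r -scalerBl mulr1; congr (_ *: _); ring.
by rewrite mulr0 scale0r subr0 expr0 scale1r.
Qed.

Lemma helm_mirror lam f i a : helm lam f -> helm lam (fun x => f (mirror i a x)).
Proof.
move=> Hf; have := helm_affine (c := fun j => (-1) ^+ (i == j)) (c2 := 1) Hf
  (affine_mirror i a).
by rewrite mul1r; apply=> j; [exact: mirror_evec|exact: sqrr_sign].
Qed.

Lemma dirD_sum v x {I : Type} (r : seq I) (f : I -> V -> R) :
  (forall i : I, smooth (f i)) ->
  dirD v (fun x => \sum_(i <- r) f i x) x = \sum_(i <- r) dirD v (f i) x.
Proof.
by move=> sf; apply: dirD_val; apply: is_derive_bigsum => i; exact: smooth_is_derive.
Qed.

Lemma helm_dirD lam f v : helm lam f -> helm lam (dirD v f).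
Proof.
move=> [sf Hf]; split; first exact: smooth_dirD.
move=> x; rewrite lapE.
have C i : dirD (e i) (dirD v f) = dirD v (dirD (e i) f).
  by apply/funext => y; exact: dirD_comm.
have E i : dirD (e i) (dirD (e i) (dirD v f)) x = dirD v (dirD (e i) (dirD (e i) f)) x.
  by rewrite C dirD_comm//; exact: smooth_dirD.
rewrite (eq_bigr _ (fun i _ => E i)) -dirD_sum; last first.
  by move=> i; apply: smooth_dirD; exact: smooth_dirD.
rewrite (_ : (fun x => _) = fun x => (- lam) * f x); last first.
  by apply/funext => y; rewrite -lapE mulNr; apply/eqP; rewrite -addr_eq0 Hf.
rewrite (_ : dirD v _ x = - lam * dirD v f x); first by rewrite mulNr addNr.
by apply: dirD_val; apply: is_derive_scale; exact: smooth_is_derive.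
Qed.

Lemma helm_scaling lam f (s : R) w : helm lam f ->
  helm (s ^+ 2 * lam) (fun x => f (w + s *: x)).
Proof.
move=> Hf; apply: (helm_affine (B := fun v => s *: v) (c := fun=> s) Hf) => //.
split.
  have c1 : continuous (fun x : V => s *: x) by exact: scaler_continuous.
  by move=> x; exact: (cvgD (cvg_cst _) (c1 x)).
by move=> x v h; rewrite scalerDr addrCA !scalerA mulrC.
Qed.

End Helmholtz.

(** * Interior gradient estimate *)
Section InteriorEstimate.
Context {R : realType} {d : nat}.
Notation V := 'rV[R]_d.
Notation e := (@evec R d).
Implicit Types (f g h : V -> R) (x v w c : V) (i j : 'I_d) (lam : R).

(** The first derivative vanishes at the maximum; if the second were positive, two applications of
    the mean value theorem would produce a larger value nearby. *)
Lemma second_derivative_max f x v (dl : R) : smooth f -> 0 < dl ->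
  (forall t : R, `|t| < dl -> f (x + t *: v) <= f x) ->
  dirD v (dirD v f) x <= 0.
Proof.
move=> sf dl0 fmax; rewrite leNgt; apply/negP => D2.
have s1 := smooth_dirD v sf; have s2 := smooth_dirD v s1.
have D1 : dirD v f x = 0.
  have := @derive1_at_max R (fun t : R => f (x + t *: v)) (- dl) dl 0.
  have dl2 : - dl <= dl by rewrite ge0_cp// ltW.
  have dt (t : R) : derivable (fun t : R => f (x + t *: v)) t 1.
    by case: (is_derive_line x v t sf).
  have in0 : (0 : R) \in `](- dl), dl[%R by rewrite in_itv /= oppr_lt0 dl0.
  move=> /(_ dl2 (fun t _ => dt t) in0) D.
  have fm t : t \in `](- dl), dl[%R -> f (x + t *: v) <= f (x + 0 *: v).
    by rewrite in_itv /= scale0r addr0 => ?; apply: fmax; rewrite ltr_norml.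
  have := is_derive_unique (D fm) (is_derive_line x v 0 sf).
  by rewrite scale0r addr0 => <-.
pose g := fun t : R => dirD v (dirD v f) (x + t *: v).
have cg : continuous g := is_derive_continuous (fun t => is_derive_line x v t s2).
have g0 : 0 < g 0 by rewrite /g scale0r addr0.
have /cvgrPdist_lt/(_ _ g0)/nbhs_ballP[r /= r0 rP] := cg 0.
pose t := Num.min dl r / 2.
have m0 : 0 < Num.min dl r by rewrite lt_min dl0 r0.
have t0 : 0 < t by rewrite divr_gt0.
have tm : t < Num.min dl r by rewrite /t ltr_pdivrMr// ltr_pMr// ltr1n.
have [tdl tr] : t < dl /\ t < r by move: tm; rewrite lt_min => /andP.
have [t1 [t10 t1t E1]] := mvt_line x v sf t0.
have [t2 [t20 t2t E2]] := mvt_line x v s1 t10.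
have gpos : 0 < g t2.
  have /rP : ball (0 : R) r t2.
    by rewrite -ball_normE /= sub0r normrN gtr0_norm// (lt_trans t2t)// (lt_trans t1t).
  by rewrite ltr_norml => /andP[_]; rewrite ltrBlDr ltrDl.
have : f (x + t *: v) <= f x by apply: fmax; rewrite gtr0_norm.
apply/negP; rewrite -ltNge -subr_gt0 E1 mulr_gt0//.
move: E2; rewrite D1 subr0 => ->.
by rewrite mulr_gt0.
Qed.

Lemma lap_max_le0 f x (dl : R) : smooth f -> 0 < dl ->
  (forall i (t : R), `|t| < dl -> f (x + t *: e i) <= f x) -> lap f x <= 0.
Proof.
move=> sf dl0 fm; rewrite lapE; apply: sumr_le0 => i _.
by apply: (second_derivative_max sf dl0) => t; exact: fm.
Qed.

Definition cube c (rho : R) : set V := [set y | forall j, `|y 0 j - c 0 j| <= rho].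

Definition half_cube i (rho : R) : set V :=
  [set y | forall j, y 0 j \in `[(if j == i then 0 else - rho), rho]].

Lemma half_cube_compact i rho : compact (half_cube i rho).
Proof.
apply: (@rV_compact R d (fun j => `[(if j == i then 0 else - rho), rho]%classic)).
by move=> j; exact: segment_compact.
Qed.

Lemma cube_compact c rho : compact (cube c rho).
Proof.
have -> : cube c rho = [set y | forall j, y 0 j \in `[c 0 j - rho, c 0 j + rho]].
  by apply/seteqP; split => y /= H j; have := H j; rewrite in_itv /= ler_distl.
apply: (@rV_compact R d (fun j => `[c 0 j - rho, c 0 j + rho]%classic)).
by move=> j; exact: segment_compact.
Qed.

Lemma continuous_bounded_cube f c rho : continuous f ->
  exists2 M, 0 <= M & forall y, cube c rho y -> `|f y| <= M.
Proof.
move=> cf; case: (pselect (cube c rho !=set0)) => [ne|emp]; last first.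
  by exists 0 => // y cy; case: emp; exists y.
have cn : continuous (fun y => `|f y|).
  move=> y; apply: (@continuous_comp V _ _ f Num.norm); first exact: cf.
  exact: norm_continuous.
have [b _ bP] := EVT_max_rV ne (@cube_compact c rho) (continuous_subspaceT cn).
by exists `|f b| => // y cy; apply: bP; rewrite inE.
Qed.

(** Maximum principle in its strict form: at an interior maximum the Laplacian would be at most 0,
    so the maximum sits on the boundary. *)
Lemma half_cube_max h i (rho : R) : smooth h -> 0 < rho ->
  (forall y, half_cube i rho y -> 0 < lap h y) ->
  (forall y, half_cube i rho y ->
     (y 0 i = 0) \/ (exists j, `|y 0 j| = rho) -> h y <= 0) ->
  forall y, half_cube i rho y -> h y <= 0.
Proof.
move=> sh rho0 hlap hbd y Ky.
have ne : half_cube i rho !=set0 by exists y.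
have [b + bP] := EVT_max_rV ne (@half_cube_compact i rho)
   (continuous_subspaceT (smooth_continuous sh)).
rewrite inE => Kb.
apply: (le_trans (bP y _)); first by rewrite inE.
case: (pselect (b 0 i = 0 \/ exists j, `|b 0 j| = rho)) => [|nb]; first exact: hbd.
have lo j : (if j == i then 0 else - rho) < b 0 j.
  have := Kb j; rewrite in_itv /= => /andP[l1 l2].
  rewrite lt_neqAle l1 andbT; apply/eqP => E; apply: nb.
  move: E; case: eqVneq => [->|_] E; [left|right; exists j] => //.
  by rewrite -E normrN gtr0_norm.
have hi j : b 0 j < rho.
  have := Kb j; rewrite in_itv /= => /andP[l1 l2].
  rewrite lt_neqAle l2 andbT; apply/eqP => E; apply: nb.
  by right; exists j; rewrite E gtr0_norm.
pose F j := Num.min (b 0 j - (if j == i then 0 else - rho)) (rho - b 0 j).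
have F0 j : 0 < F j by rewrite lt_min !subr_gt0 lo hi.
(* Distance from b to the faces, capped at 1; b can move by less than this in any coordinate without
   leaving the half cube. *)
pose dl := \big[Num.min/1]_j F j.
have dl0 : 0 < dl by rewrite /dl; elim/big_ind : _ => // p q p0 q0; rewrite lt_min p0.
have dlF j : dl <= F j by exact: bigmin_le_cond.
have : lap h b <= 0.
  apply: (lap_max_le0 sh dl0) => k t tdl; apply: bP; rewrite inE => j.
  have := dlF j; rewrite le_min => /andP[d1 d2].
  have tk : `|t * e k 0 j| < dl.
    rewrite evecE; case: (k == j); rewrite ?mulr1//.
    by rewrite mulr0 normr0.
  move: tk; rewrite ltr_norml => /andP[t1 t2].
  have -> : (b + t *: e k) 0 j = b 0 j + t * e k 0 j by rewrite !mxE.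
  rewrite in_itv /=.
  move: d1 d2 t1 t2; move: (if j == i then 0 else _) (t * _) (b 0 j) => p q s.
  by move=> d1 d2 t1 t2; apply/andP; split; lra.
by rewrite leNgt hlap.
Qed.

Lemma lap_sqnorm x : lap (fun y : V => \sum_j y 0 j * y 0 j) x = 2 * d%:R.
Proof.
rewrite lapE (eq_bigr (fun=> 2)).
  by rewrite sumr_const card_ord mulr_natr.
move=> i _.
have -> : dirD (e i) (fun y : V => \sum_j y 0 j * y 0 j) = fun y => 2 * y 0 i.
  apply/funext => y; apply: dirD_val.
  rewrite (_ : 2 * y 0 i = \sum_j (y 0 j * e i 0 j + e i 0 j * y 0 j)).
    by apply: is_derive_bigsum => j; apply: is_derive_mul; exact: is_derive_coord.
  rewrite (bigD1 i)//= big1 => [|j ji].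
    by rewrite evecE eqxx addr0 mulr1 mul1r -mulr2n mulr_natl.
  by rewrite evecE eq_sym (negbTE ji) mulr0 mul0r addr0.
apply: dirD_val; rewrite -[X in is_derive _ _ _ X]mulr1.
apply: is_derive_scale; have := is_derive_coord i x (e i).
by rewrite evecE eqxx.
Qed.

Lemma lap_parabola i (rho : R) x : lap (fun y : V => y 0 i * (rho - y 0 i)) x = - 2.
Proof.
have D j y : dirD (e j) (fun y : V => y 0 i * (rho - y 0 i)) y =
    e j 0 i * (rho - 2 * y 0 i).
  apply: dirD_val.
  rewrite (_ : e j 0 i * _ = y 0 i * (0 - e j 0 i) + e j 0 i * (rho - y 0 i)).
    apply: is_derive_mul; first exact: is_derive_coord.
    exact: is_derive_sub (is_derive_const _ _ _) (is_derive_coord _ _ _).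
  by move: (e j 0 i) (y 0 i) => p q; ring.
rewrite lapE (bigD1 i)//= big1 ?addr0 => [|j ji]; rewrite (funext (D _)).
  apply: dirD_val; rewrite (_ : - 2 = e i 0 i * (0 - 2 * e i 0 i)).
    apply: is_derive_scale; apply: (is_derive_sub (is_derive_const _ _ _)).
    by apply: is_derive_scale; exact: is_derive_coord.
  by rewrite evecE eqxx mul1r mulr1 sub0r.
apply: dirD_val; rewrite evecE (negbTE ji); under eq_fun do rewrite mul0r.
exact: is_derive_const.
Qed.

(* Comparison function of Gilbarg and Trudinger, Section 3.4: on the half cube it
   dominates the odd part of f in the i-th variable, which vanishes on x_i = 0. *)
Definition barrier (a b rho : R) i (y : V) : R :=
  a * (\sum_j y 0 j * y 0 j) + b * (y 0 i * (rho - y 0 i)).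

Lemma smooth_sqnorm : smooth (fun y : V => \sum_j y 0 j * y 0 j).
Proof. by apply: smooth_sum => j; apply: smooth_mul; exact: smooth_coord. Qed.

Lemma smooth_parabola i (rho : R) : smooth (fun y : V => y 0 i * (rho - y 0 i)).
Proof.
apply: smooth_mul; first exact: smooth_coord.
have := smooth_lin rho (-1) (smooth_const 1) (smooth_coord i).
by congr smooth; apply/funext => y; rewrite mulr1 mulN1r.
Qed.

Lemma barrier_smooth a b rho i : smooth (barrier a b rho i).
Proof. exact: (smooth_lin a b smooth_sqnorm (smooth_parabola i rho)). Qed.

Lemma barrier_lap a b rho i y : lap (barrier a b rho i) y = 2 * a * d%:R - 2 * b.
Proof.
rewrite (lap_lin a b y smooth_sqnorm (smooth_parabola i rho)).
by rewrite lap_sqnorm lap_parabola; move: (d%:R : R) => p; ring.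
Qed.

Lemma mirror_fix i a (y : V) : y 0 i = a -> mirror i a y = y.
Proof. by rewrite /mirror => ->; rewrite subrr mulr0 scale0r addr0. Qed.

Lemma cube_mirror i rho (y : V) : cube 0 rho y -> cube 0 rho (mirror i 0 y).
Proof.
move=> cy j; rewrite !mxE sub0r subr0; have := cy j; rewrite mxE subr0.
rewrite eqxx /=; case: (eqVneq j i) => [->|_] /=; last by rewrite mulr0 addr0.
by rewrite mulr1 (_ : y 0 i + _ = - y 0 i) ?normrN//; ring.
Qed.

Lemma half_cube_sub i rho (y : V) : 0 < rho -> half_cube i rho y -> cube 0 rho y.
Proof.
move=> rho0 hy j; have := hy j; rewrite mxE subr0 in_itv /= ler_norml.
case: (j == i) => /andP[y0 ->]; rewrite andbT//.
by apply: le_trans y0; rewrite oppr_le0 ltW.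
Qed.

(** The constants are forced: a = M/rho^2 makes the barrier at least M where some |y_j| = rho, and b
    = d M/rho^2 + N/2 makes its Laplacian equal to -N. The strict inequality lam M < N gives the
    difference a strictly positive Laplacian, as [half_cube_max] requires. *)
Lemma odd_part_le_barrier lam f i (rho M N : R) : helm lam f -> 0 <= lam ->
  0 < rho -> (forall y, cube 0 rho y -> `|f y| <= M) -> lam * M < N ->
  forall y, half_cube i rho y ->
   2^-1 * f y + (- 2^-1) * f (mirror i 0 y) <=
   barrier (M / rho ^+ 2) (d%:R * M / rho ^+ 2 + N / 2) rho i y.
Proof.
move=> Hf lam0 rho0 fM MN.
set a := M / _; set b := _ + N / 2.
have Hp := helm_lin (2^-1) (- 2^-1) Hf (helm_mirror i 0 Hf).
set p := (fun x => _) in Hp.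
have M0 : 0 <= M.
  have /fM : cube 0 rho 0 by move=> j; rewrite subrr normr0 ltW.
  exact: le_trans.
have N0 : 0 < N by apply: le_lt_trans MN; rewrite mulr_ge0.
have a0 : 0 <= a by rewrite divr_ge0// sqr_ge0.
have b0 : 0 <= b by rewrite addr_ge0// divr_ge0// ?sqr_ge0 ?mulr_ge0// ltW.
have pM y : cube 0 rho y -> `|p y| <= M.
  move=> cy; have := fM _ cy; have := fM _ (cube_mirror i cy).
  rewrite /p; move: (f y) (f _) => s t; rewrite !ler_norml => /andP[t1 t2] /andP[s1 s2].
  by apply/andP; split; lra.
have sb := barrier_smooth a b rho i.
have sh := smooth_lin 1 (-1) Hp.1 sb.
suff H y : half_cube i rho y -> 1 * p y + (-1) * barrier a b rho i y <= 0.
  by move=> y /H; rewrite mul1r mulN1r subr_le0.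
apply: (half_cube_max sh rho0) => {}y hy; have cy := half_cube_sub rho0 hy.
  rewrite (lap_lin 1 (-1) y Hp.1 sb) barrier_lap -[lap p y]opprK (addr0_eq (Hp.2 y)).
  rewrite mul1r mulN1r.
  have -> : 2 * a * d%:R - 2 * b = - N.
    by rewrite /a /b; move: (d%:R : R) => q; field; rewrite gt_eqF.
  rewrite opprK addrC subr_gt0; apply: le_lt_trans MN; rewrite ler_wpM2l//.
  by apply: le_trans (pM _ cy); exact: ler_norm.
have yi : 0 <= y 0 i * (rho - y 0 i).
  have := hy i; rewrite eqxx in_itv /= => /andP[y0 y1].
  by rewrite mulr_ge0// subr_ge0.
have sq0 : 0 <= \sum_j y 0 j * y 0 j.
  by apply: sumr_ge0 => j _; rewrite -expr2 sqr_ge0.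
rewrite mul1r mulN1r subr_le0 => -[y0|[j yj]].
  rewrite /p mirror_fix// mulNr subrr /barrier.
  by rewrite addr_ge0// mulr_ge0.
apply: le_trans (ler_norm _) _; apply: le_trans (pM _ cy) _.
rewrite /barrier ler_wpDr//; first exact: mulr_ge0.
have -> : M = a * rho ^+ 2 by rewrite /a divfK// expf_neq0// gt_eqF.
rewrite ler_wpM2l// (bigD1 j)//= -expr2 -[y 0 j ^+ 2]real_normK ?num_real// yj.
rewrite ler_wpDr//; apply: sumr_ge0 => k _; by rewrite -expr2 sqr_ge0.
Qed.

Lemma dirD_mirror i a f x : smooth f ->
  dirD (e i) (fun y => f (mirror i a y)) x = - dirD (e i) f (mirror i a x).
Proof.
move=> sf; rewrite (dirD_affine _ _ sf (affine_mirror i a)) mirror_evec eqxx expr1.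
by rewrite dirD_scalev// mulN1r.
Qed.

(** The odd part has the same i-th derivative at 0 as f. At t e_i the barrier equals a t^2 + b t
    (rho - t), so division by t and t -> 0 give the bound b rho. *)
Lemma gradient_at0_le lam f i (rho M N : R) : helm lam f -> 0 <= lam ->
  0 < rho -> (forall y, cube 0 rho y -> `|f y| <= M) -> lam * M < N ->
  dirD (e i) f 0 <= (d%:R * M / rho ^+ 2 + N / 2) * rho.
Proof.
move=> Hf lam0 rho0 fM MN.
have main := odd_part_le_barrier (i := i) Hf lam0 rho0 fM MN.
set a := M / _ in main; set b := _ + N / 2 in main *.
have Hp := helm_lin (2^-1) (- 2^-1) Hf (helm_mirror i 0 Hf).
have sr := smooth_affine Hf.1 (affine_mirror i 0).
set p := (fun x => _) in Hp.
have M0 : 0 <= M.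
  have /fM : cube 0 rho 0 by move=> j; rewrite subrr normr0 ltW.
  exact: le_trans.
have N0 : 0 < N by apply: le_lt_trans MN; rewrite mulr_ge0.
have a0 : 0 <= a by rewrite divr_ge0// sqr_ge0.
have b0 : 0 <= b by rewrite addr_ge0// divr_ge0// ?sqr_ge0 ?mulr_ge0// ltW.
have Dp0 : dirD (e i) p 0 = dirD (e i) f 0.
  rewrite (dirD_lin _ _ _ _ Hf.1 sr) dirD_mirror ?mirror_fix ?mxE//; last exact: Hf.1.
  by move: (dirD _ _ _) => t; field.
have p0 : p 0 = 0 by rewrite /p mirror_fix ?mxE// mulNr subrr.
rewrite -Dp0 leNgt; apply/negP => lt.
set G := dirD (e i) p 0 in lt.
have eps0 : 0 < (G - b * rho) / 2 by rewrite divr_gt0// subr_gt0.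
have s1 := smooth_dirD (e i) Hp.1.
have cg : continuous (fun t : R => dirD (e i) p (0 + t *: e i)) :=
  is_derive_continuous (fun t => is_derive_line 0 (e i) t s1).
have /cvgrPdist_lt/(_ _ eps0)/nbhs_ballP[r /= r0 rP] := cg 0.
(* Below rho to stay in the half cube, below r for continuity of the derivative, and below (G - b
   rho)/2/(a + 1) so that a t is negligible. *)
pose t := Num.min rho (Num.min r ((G - b * rho) / 2 / (a + 1))) / 2.
set m := Num.min rho _ in t.
have a10 : 0 < a + 1 by rewrite ltr_wpDl.
have m0 : 0 < m by rewrite !lt_min rho0 r0 divr_gt0.
have t0 : 0 < t by rewrite divr_gt0.
have : t < m by rewrite /t ltr_pdivrMr// ltr_pMr// ltr1n.
rewrite !lt_min => /and3P[trho tr ta].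
have [s [s0 st E]] := mvt_line 0 (e i) Hp.1 t0.
have : ball (0 : R) r s.
  by rewrite -ball_normE /= sub0r normrN gtr0_norm// (lt_trans st).
move=> /rP; rewrite scale0r addr0 -/G => Gs.
have hy : half_cube i rho (0 + t *: e i).
  move=> j; rewrite add0r mxE evecE in_itv /= eq_sym.
  case: (i == j); rewrite ?mulr1 ?mulr0; apply/andP; split; rewrite ?oppr_le0;
    exact: ltW.
have := main _ hy.
rewrite -/(p (0 + t *: e i)) -[p _]subr0 -[X in _ - X]p0 E.
rewrite /barrier (bigD1 i)//= big1; last first.
  by move=> j ji; rewrite add0r mxE evecE eq_sym (negbTE ji) !mulr0.
have et : (0 + t *: e i) 0 i = t by rewrite !mxE !eqxx mulr1 add0r.
rewrite et addr0.
rewrite [X in X <= _]mulrC => le1.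
have le2 : dirD (e i) p (0 + s *: e i) <= a * t + b * (rho - t).
  rewrite -(ler_pM2l t0); apply: (le_trans le1).
  by rewrite le_eqVlt; apply/orP; left; apply/eqP; move: (a) (b) (t) => q1 q2 q3; ring.
have at1 : a * t < (G - b * rho) / 2.
  apply: (@le_lt_trans _ _ (t * (a + 1))); first by rewrite mulrC ler_wpM2l ?ltW// ltrDl.
  by rewrite -ltr_pdivlMr.
have bt : 0 <= b * t by rewrite mulr_ge0// ltW.
move: Gs le2; rewrite ltr_norml => /andP[_].
move: (dirD (e i) p _) => D Gs le2.
have := ltr_leD Gs le2; rewrite mulrBr.
move: (b * rho) (b * t) (a * t) at1 bt => u1 u2 u3; lra.
Qed.

Lemma gradient_at0 lam f i (rho M : R) : helm lam f -> 0 <= lam ->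
  0 < rho -> (forall y, cube 0 rho y -> `|f y| <= M) ->
  dirD (e i) f 0 <= (d%:R / rho + lam * rho / 2) * M.
Proof.
move=> Hf lam0 rho0 fM; apply/ler_addgt0Pr => eps eps0.
(* N is sent to lam M; the excess 2 eps/rho contributes exactly eps to the bound. *)
have NM : lam * M < lam * M + 2 * eps / rho.
  by rewrite ltrDl divr_gt0// mulr_gt0.
apply: (le_trans (gradient_at0_le i Hf lam0 rho0 fM NM)).
rewrite le_eqVlt; apply/orP; left; apply/eqP.
by move: (d%:R : R) => q; field; rewrite gt_eqF.
Qed.

Lemma interior_gradient lam f c i (rho M : R) : helm lam f -> 0 <= lam ->
  0 < rho -> (forall y, cube c rho y -> `|f y| <= M) ->
  `|dirD (e i) f c| <= (d%:R / rho + lam * rho / 2) * M.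
Proof.
move=> Hf lam0 rho0 fM.
have Hg := helm_shift c Hf.
have gM y : cube 0 rho y -> `|f (y + c)| <= M.
  by move=> cy; apply: fM => j; have := cy j; rewrite !mxE subr0 addrK.
have Dg : dirD (e i) (fun y => f (y + c)) 0 = dirD (e i) f c.
  by rewrite (dirD_affine _ _ Hf.1 (affine_shift c)) add0r.
rewrite ler_norml lerNl -Dg; apply/andP; split.
  have := gradient_at0 i (helm_scale (-1) Hg) lam0 rho0.
  move=> /(_ M) H; rewrite -mulN1r.
  have <- : dirD (e i) (fun x => -1 * f (x + c)) 0 = -1 * dirD (e i) (fun y => f (y + c)) 0.
    by apply: dirD_val; apply: is_derive_scale; exact: smooth_is_derive Hg.1.
  by apply: H => y cy; rewrite mulN1r normrN gM.
exact: gradient_at0.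
Qed.

End InteriorEstimate.

(** * Analyticity along coordinate lines *)
Section Analyticity.
Context {R : realType} {d : nat}.
Notation V := 'rV[R]_d.
Notation e := (@evec R d).
Implicit Types (f g h u : V -> R) (x v w c : V) (i j : 'I_d) (lam : R).

Lemma helm_iter lam f v k : helm lam f -> helm lam (iter k (dirD v) f).
Proof. by move=> Hf; elim: k => //= k; exact: helm_dirD. Qed.

(** Each differentiation shrinks the cube by 1/n and costs d n + lam/(2n), at most (d + lam) n. For
    k = n the total loss of radius is 1, whatever n is. *)
Lemma interior_iter lam k n f c i (M : R) : helm lam f -> 0 <= lam -> (0 < n)%N ->
  (forall y, cube c (k%:R / n%:R) y -> `|f y| <= M) ->
  `|iter k (dirD (e i)) f c| <= ((d%:R + lam) * n%:R) ^+ k * M.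
Proof.
move=> Hf lam0 n0; elim: k f M c Hf => [|k IH] f M c Hf fM.
  by rewrite expr0 mul1r; apply: fM => j; rewrite subrr normr0 mul0r.
have nR0 : 0 < n%:R :> R by rewrite ltr0n.
have nR1 : 1 <= n%:R :> R by rewrite ler1n.
rewrite iterSr exprSr -mulrA; apply: IH; first exact: helm_dirD.
move=> y cy.
have M0 : 0 <= M.
  apply: le_trans (fM c _) => //= j; rewrite subrr normr0.
  by rewrite divr_ge0.
have rho0 : 0 < n%:R^-1 :> R by rewrite invr_gt0.
apply: le_trans (interior_gradient i Hf lam0 rho0 (M := M) _) _.
  move=> z cz; apply: fM => j.
  have -> : z 0 j - c 0 j = (z 0 j - y 0 j) + (y 0 j - c 0 j) by rewrite addrA subrK.
  apply: le_trans (ler_normD _ _) _.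
  by rewrite -(natr1 k) mulrDl mul1r addrC; apply: lerD; [exact: cy|exact: cz].
rewrite ler_wpM2r// invrK mulrDl lerD2l -mulrA ler_wpM2l//.
apply: (@le_trans _ _ 1) => //.
rewrite -invfM invf_le1; last by rewrite mulr_gt0.
by move: nR1; lra.
Qed.

Lemma is_derive_pow n (z : R) : is_derive z 1 (fun t : R => t ^+ n) (n%:R * z ^+ n.-1).
Proof.
by apply: DeriveDef; [exact: exprn_derivable|rewrite exp_derive [_ *: 1]mulr1].
Qed.

(** Taylor remainder without integrals: induction over the shifted family, comparing both signs of g
    0 with B t^n/n! by the mean value theorem. *)
Lemma taylor_bound (g : nat -> R -> R) (s B : R) n :
  (forall k (t : R), is_derive t 1 (g k) (g k.+1 t)) ->
  (forall k, g k 0 = 0) ->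
  (forall t : R, 0 <= t <= s -> `|g n t| <= B) ->
  forall t : R, 0 <= t <= s -> `|g 0 t| <= B * t ^+ n / n`!%:R.
Proof.
elim: n g => [|n IH] g dg g0 gB t ts.
  by rewrite expr0 mulr1 fact0 divr1; exact: gB.
have {}IH := IH (fun k => g k.+1) (fun k => dg k.+1) (fun k => g0 k.+1) gB.
have [t0|t0] := ltrP 0 t; last first.
  have -> : t = 0 by apply/eqP; rewrite eq_le t0; case/andP: ts.
  by rewrite g0 normr0 expr0n mulr0 mul0r.
have [_ ts2] := andP ts.
pose c := B / n.+1`!%:R.
have dpow (z : R) : is_derive z 1 (fun t : R => c * t ^+ n.+1) (B * z ^+ n / n`!%:R).
  rewrite (_ : B * _ / _ = c * (n.+1%:R * z ^+ n)).
    by apply: is_derive_scale; exact: (is_derive_pow n.+1).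
  rewrite /c factS natrM; field.
  by rewrite addrC natr1 !pnatr_eq0 -!lt0n fact_gt0.
have pow0 : c * 0 ^+ n.+1 = 0 by rewrite expr0n mulr0.
suff H (sg : R) : `|sg| = 1 -> sg * g 0%N t <= c * t ^+ n.+1.
  rewrite [B * _ / _]mulrAC -/c ler_norml lerNl -mulN1r -[X in _ && (X <= _)]mul1r.
  by rewrite !H// ?normrN normr1.
move=> sg1.
have dh (z : R) : is_derive z 1 (fun t : R => c * t ^+ n.+1 - sg * g 0%N t)
   (B * z ^+ n / n`!%:R - sg * g 1%N z).
  by apply: is_derive_sub; apply: is_derive_scale.
have [z [z0 zt E]] := mvt_itv t0 dh.
rewrite -subr_ge0; move: E; rewrite pow0 g0 mulr0 !subr0 => ->.
rewrite mulr_ge0 ?subr_ge0 ?(ltW t0)//.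
apply: le_trans (ler_norm _) _; rewrite normrM sg1 mul1r; apply: IH.
by rewrite (ltW z0) (le_trans (ltW zt)).
Qed.

(** The left side is one term of the exponential series of e^n. *)
Lemma pow_fact_le n : (0 < n)%N -> n%:R ^+ n / n`!%:R <= expR 1 ^+ n :> R.
Proof.
case: n => // n _; rewrite -expRM_natl mulr1.
apply: le_trans (expR_ge1Dxn n _) => //; by rewrite lerDr.
Qed.

Lemma le0_of_geometric (a M : R) : (forall n, (0 < n)%N -> a <= M * 2^-1 ^+ n) -> a <= 0.
Proof.
move=> H; rewrite leNgt; apply/negP => a0.
have [n nP] : exists n : nat, M / a < n%:R.
  by exists (Num.truncn `|M / a|).+1; apply: le_lt_trans (ler_norm _) (truncnS_gt _).
have n1 : (0 < n.+1)%N by [].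
have := H n.+1 n1; rewrite exprVn ler_pdivlMr ?exprn_gt0//.
apply/negP; rewrite -ltNge.
move: nP; rewrite ltr_pdivrMr// => nP; apply: (lt_le_trans nP).
rewrite mulrC ler_wpM2l ?(ltW a0)// -natrX ler_nat.
exact: leq_trans (leqnSn n) (ltnW (ltn_expl n.+1 (ltnSn 1))).
Qed.

Definition flat i f x := forall k, iter k (dirD (e i)) f x = 0.

(** A step s of at most this length has s (d + lam) e <= 1/2, so the n-th Taylor remainder is at
    most M 2^-n. The length depends neither on the solution nor on the base point, which lets
    flatness travel along a whole line. *)
Definition analytic_step lam : R := (2 * (d%:R + lam + 1) * expR 1)^-1.

Lemma analytic_step_gt0 lam : 0 <= lam -> 0 < analytic_step lam.
Proof.
by move=> lam0; rewrite invr_gt0 mulr_gt0 ?expR_gt0// mulr_gt0// ltr_wpDl// addr_ge0.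
Qed.

(* The n-th derivative is at most (C n)^n M, and n^n / n! <= e^n. *)
Lemma flat_local lam f i x (s : R) : helm lam f -> 0 <= lam -> flat i f x ->
  0 <= s <= analytic_step lam -> f (x + s *: e i) = 0.
Proof.
move=> Hf lam0 fl /andP[s0 sd].
have [M M0 MP] := continuous_bounded_cube x (s + 1) (smooth_continuous Hf.1).
apply/eqP; rewrite -normr_le0.
apply: (@le0_of_geometric _ M) => n n0.
have nR0 : 0 < n%:R :> R by rewrite ltr0n.
pose C : R := d%:R + lam; have C0 : 0 <= C by rewrite addr_ge0.
have bd (t : R) : 0 <= t <= s -> `|iter n (dirD (e i)) f (x + t *: e i)| <= (C * n%:R) ^+ n * M.
  move=> /andP[t0 ts]; apply: interior_iter => // y cy; apply: MP => j.
  have := cy j; rewrite divff ?gt_eqF//.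
  have -> : (x + t *: e i) 0 j = x 0 j + t * (i == j)%:R by rewrite -evecE !mxE.
  move=> cj.
  have -> : y 0 j - x 0 j = (y 0 j - (x 0 j + t * (i == j)%:R)) + t * (i == j)%:R.
    by rewrite opprD addrA subrK.
  rewrite [s + 1]addrC; apply: le_trans (ler_normD _ _) _; apply: lerD => //.
  by case: (i == j); rewrite ?mulr1 ?mulr0 ?normr0 ?ger0_norm.
have T := @taylor_bound (fun k t => iter k (dirD (e i)) f (x + t *: e i)) s _ n
  (fun k t => is_derive_line x (e i) t (helm_iter (e i) k Hf).1) _ bd s.
apply: (le_trans (T _ _)).
- by move=> k; rewrite scale0r addr0 fl.
- by rewrite s0 lexx.
have -> : (C * n%:R) ^+ n * M * s ^+ n / n`!%:R = M * ((s * C) ^+ n * (n%:R ^+ n / n`!%:R)).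
  rewrite !exprMn; move: (C ^+ n) (n%:R ^+ n) (s ^+ n) (n`!%:R^-1) => c1 c2 c3 c4.
  by ring.
rewrite ler_wpM2l//.
have hC : 0 <= s * C by rewrite mulr_ge0.
apply: (@le_trans _ _ ((s * C) ^+ n * expR 1 ^+ n)).
  by rewrite ler_wpM2l ?exprn_ge0// pow_fact_le.
rewrite -exprMn lerXn2r ?nnegrE ?mulr_ge0 ?expR_ge0 ?invr_ge0//.
have E0 : 0 < expR 1 :> R := expR_gt0 1.
apply: (@le_trans _ _ (analytic_step lam * (C + 1) * expR 1)).
  rewrite ler_wpM2r ?(ltW E0)//; apply: ler_pM => //.
  by rewrite lerDl.
rewrite /analytic_step -/C le_eqVlt; apply/orP; left; apply/eqP.
have C10 : C + 1 != 0 by rewrite gt_eqF// ltr_wpDl.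
by field; rewrite C10 gt_eqF.
Qed.

(** All derivatives of f solve the same equation, so vanishing within one step is inherited by each
    of them and flatness itself moves on; finitely many steps t/n reach t. *)
Lemma flat_forward lam f i x (t : R) : helm lam f -> 0 <= lam -> flat i f x ->
  0 <= t -> f (x + t *: e i) = 0.
Proof.
move=> Hf lam0 fl t0; have st0 := analytic_step_gt0 lam0.
have step y (s : R) : flat i f y -> 0 <= s <= analytic_step lam -> flat i f (y + s *: e i).
  move=> fy sd k; apply: (flat_local (helm_iter (e i) k Hf) lam0 _ sd) => m.
  by rewrite -iterD; exact: fy.
have [n nP] : exists n : nat, t / analytic_step lam < n%:R.
  by exists (Num.truncn `|t / analytic_step lam|).+1;
    apply: le_lt_trans (ler_norm _) (truncnS_gt _).
have n0 : 0 < n%:R :> R by apply: le_lt_trans nP; rewrite divr_ge0// ltW.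
have sP : 0 <= t / n%:R <= analytic_step lam.
  rewrite divr_ge0 ?(ltW n0)//= ler_pdivrMr// mulrC -ler_pdivrMr//.
  exact: ltW.
suff H m : flat i f (x + (m%:R * (t / n%:R)) *: e i).
  by have := H n 0%N; rewrite mulrC divfK// gt_eqF.
elim: m => [|m IH]; first by rewrite mul0r scale0r addr0.
have -> : x + (m.+1%:R * (t / n%:R)) *: e i =
   x + (m%:R * (t / n%:R)) *: e i + (t / n%:R) *: e i.
  by rewrite -addrA -scalerDl -natr1 [X in _ = x + X *: _]addrC mulrDl mul1r addrC.
exact: step.
Qed.

Lemma helm_mirror_iter lam f i a k : helm lam f ->
  iter k (dirD (e i)) (fun y => f (mirror i a y)) =
  fun y => (-1) ^+ k * iter k (dirD (e i)) f (mirror i a y).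
Proof.
move=> Hf; elim: k => [|k IH] /=; first by apply/funext => y; rewrite mul1r.
have Hk := helm_iter (e i) k Hf.
rewrite IH; apply/funext => y; rewrite exprS mulN1r mulNr -mulrN -(dirD_mirror _ _ _ Hk.1).
apply: dirD_val; apply: is_derive_scale; apply: smooth_is_derive.
exact: (helm_mirror i a Hk).1.
Qed.

Lemma flat_line lam f i x (t : R) : helm lam f -> 0 <= lam -> flat i f x ->
  f (x + t *: e i) = 0.
Proof.
move=> Hf lam0 fl; have [t0|t0] := leP 0 t; first exact: flat_forward Hf _ _ _.
have Hm := helm_mirror i (x 0 i) Hf.
have fm : flat i (fun y => f (mirror i (x 0 i) y)) x.
  by move=> k; rewrite (helm_mirror_iter _ _ _ Hf) mirror_fix// fl mulr0.
have := flat_forward Hm lam0 fm (t := - t); rewrite oppr_ge0 (ltW t0) => /(_ isT) <-.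
congr f; apply/rowP => j; rewrite /mirror !mxE eqxx.
by case: (eqVneq j i) => [->|_] /=; rewrite ?eqxx/=; ring.
Qed.

Lemma zero_line lam f i x (r : R) : helm lam f -> 0 <= lam -> 0 < r ->
  (forall t : R, `|t| < r -> f (x + t *: e i) = 0) ->
  forall t : R, f (x + t *: e i) = 0.
Proof.
move=> Hf lam0 r0 fz t; apply: (flat_line _ Hf lam0).
suff H k (s : R) : `|s| < r -> iter k (dirD (e i)) f (x + s *: e i) = 0.
  by move=> k; have := H k 0; rewrite normr0 scale0r addr0 => ->.
elim: k s => [|k IH] s sr /=; first exact: fz.
have sk := (helm_iter (e i) k Hf).1.
have rr : - r <= r by rewrite ge0_cp// ltW.
have dt (z : R) : derivable (fun z : R => iter k (dirD (e i)) f (x + z *: e i)) z 1.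
  by case: (is_derive_line x (e i) z sk).
have sI : s \in `](- r), r[%R by rewrite in_itv /= -ltr_norml.
(* A function vanishing on the interval has a maximum at each of its points, hence derivative zero
   there. *)
have mx z : z \in `](- r), r[%R -> iter k (dirD (e i)) f (x + z *: e i) <=
    iter k (dirD (e i)) f (x + s *: e i).
  by rewrite in_itv /= -ltr_norml => zr; rewrite !IH.
have D := @derive1_at_max R _ (- r) r s rr (fun z _ => dt z) sI mx.
by rewrite (is_derive_unique (is_derive_line x (e i) s sk) D).
Qed.

(** The box constraints are removed one coordinate at a time: in the auxiliary claim, [s] lists the
    coordinates already free, and [zero_line] frees the next one. *)
Lemma zero_hyperplane lam f i a (L : 'I_d -> R) : helm lam f -> 0 <= lam ->
  (forall j, 0 < L j) ->
  (forall x, x 0 i = a -> (forall j, j != i -> 0 < x 0 j < L j) -> f x = 0) ->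
  forall x, x 0 i = a -> f x = 0.
Proof.
move=> Hf lam0 L0 fz.
suff H (s : seq 'I_d) x : x 0 i = a ->
   (forall j, j != i -> j \notin s -> 0 < x 0 j < L j) -> f x = 0.
  by move=> x xa; apply: (H (enum 'I_d)) => // j _; rewrite mem_enum.
elim: s x => [|j s IH] x xa xs; first by apply: fz => // j ji; exact: xs.
have [ji|ji] := eqVneq j i.
  apply: IH => // k ki ks; apply: xs => //.
  by rewrite inE negb_or ji ki.
have L2 : 0 < L j / 2 by rewrite divr_gt0.
(* The j-th coordinate is moved to the midpoint of its interval, around which f is known to
   vanish. *)
pose y := x + (L j / 2 - x 0 j) *: e j.
have yE k (t : R) : (y + t *: e j) 0 k = if j == k then L j / 2 + t else x 0 k.
  rewrite /y !mxE eqxx /= eq_sym; case: (eqVneq j k) => [<-|_].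
    by rewrite !mulr1 addrCA subrr addr0.
  by rewrite !mulr0 !addr0.
have fy (t : R) : `|t| < L j / 2 -> f (y + t *: e j) = 0.
  move=> tL; apply: IH; first by rewrite yE (negbTE ji).
  move=> k ki ks; rewrite yE; case: (eqVneq j k) => [<-|jk].
    by move: tL; rewrite ltr_norml => /andP[t1 t2]; apply/andP; split; lra.
  by apply: xs => //; rewrite inE negb_or eq_sym jk.
have := zero_line Hf lam0 L2 fy (x 0 j - L j / 2).
congr (f _ = 0); apply/rowP => k; rewrite yE; case: (eqVneq j k) => [<-|//].
by rewrite addrCA subrr addr0.
Qed.

Lemma dirD_hyperplane f i j a : smooth f -> j != i ->
  (forall x, x 0 i = a -> f x = 0) -> forall x, x 0 i = a -> dirD (e j) f x = 0.
Proof.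
move=> sf ji fz x xa.
have := is_derive_line x (e j) 0 sf; rewrite scale0r addr0.
rewrite (_ : (fun s : R => _) = fun=> 0).
  by move=> D; exact: is_derive_unique D (is_derive_const _ _ _).
apply/funext => t; apply: fz.
by rewrite !mxE [i == j]eq_sym (negbTE ji) andbF mulr0 addr0.
Qed.

(** With zero Cauchy data, tangential derivatives vanish on the hyperplane and the equation makes
    the second normal derivative vanish too. Hence [dirD (e i)] preserves zero Cauchy data, f is
    flat in the normal direction, and [flat_line] applies. *)
Lemma cauchy_unique lam f i a : helm lam f -> 0 <= lam ->
  (forall x, x 0 i = a -> f x = 0) -> (forall x, x 0 i = a -> dirD (e i) f x = 0) ->
  forall x, f x = 0.
Proof.
move=> Hf lam0 f0 f1 x.
pose Z g := [/\ helm lam g, forall x, x 0 i = a -> g x = 0 &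
                 forall x, x 0 i = a -> dirD (e i) g x = 0].
have Zd g : Z g -> Z (dirD (e i) g).
  move=> [Hg g0 g1]; split => //; first exact: helm_dirD.
  move=> y ya; have := Hg.2 y; rewrite g0// mulr0 addr0 lapE (bigD1 i)//= big1.
    by rewrite addr0.
  move=> j ji; apply: (dirD_hyperplane _ ji _ ya); first exact: smooth_dirD Hg.1.
  exact: dirD_hyperplane Hg.1 ji g0.
have Zk k : Z (iter k (dirD (e i)) f).
  by elim: k => [|k IH]; [split|exact: Zd].
pose y := x + (a - x 0 i) *: e i.
have ya : y 0 i = a by rewrite !mxE !eqxx mulr1 addrCA subrr addr0.
have -> : x = y + (x 0 i - a) *: e i.
  by rewrite /y -addrA -scalerDl -[x 0 i - a]opprB subrr scale0r addr0.
apply: (flat_line _ Hf lam0) => k.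
by have [_ -> //] := Zk k.
Qed.

End Analyticity.

(** * Periodic solutions *)
Section PeriodicSolutions.
Context {R : realType} {d : nat}.
Notation V := 'rV[R]_d.
Notation e := (@evec R d).
Implicit Types (f g h u : V -> R) (x v w c : V) (i j : 'I_d) (lam : R).

Definition face_sign (bc : BC) : R := match bc with Dirichlet => -1 | Neumann => 1 end.

Lemma eigsp_helm bc l lam u : eigsp bc l lam u -> helm lam u.
Proof. by case=> su [Hu _]. Qed.

(** Reflection principle. For u minus its signed reflection, one half of the Cauchy data vanishes by
    symmetry and the other by the boundary condition, once that is extended from the face to its
    hyperplane. *)
Lemma eigsp_mirror bc l lam u i (a : R) : (forall j, 0 < side l j) -> 0 <= lam ->
  eigsp bc l lam u -> a = 0 \/ a = side l i ->
  forall x, u (mirror i a x) = face_sign bc * u x.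
Proof.
move=> l0 lam0 Eu aE; have Hu := eigsp_helm Eu.
have Hm := helm_mirror i a Hu.
have face x : x 0 i = a -> (forall j, j != i -> 0 < x 0 j < side l j) -> onFace l i x.
  move=> xa xj; split; first by rewrite xa.
  move=> j; have [->|ji] := eqVneq j i; last by have /andP[/ltW -> /ltW ->] := xj _ ji.
  by rewrite xa; case: aE => ->; rewrite ?lexx ltW.
have bnd := Eu.2.2.
suff Z x : u x - face_sign bc * u (mirror i a x) = 0.
  move=> x; have /eqP := Z x; rewrite subr_eq0 => /eqP ->.
  by rewrite /face_sign; case: (bc); rewrite ?mulN1r ?opprK ?mul1r.
have Hw : helm lam (fun x => 1 * u x + (- face_sign bc) * u (mirror i a x)).
  exact: helm_lin.
transitivity (1 * u x + (- face_sign bc) * u (mirror i a x)); first by rewrite mul1r mulNr.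
case: bc {Eu} bnd Hw => /= bnd Hw.
- have u0 := zero_hyperplane Hu lam0 l0 (fun y ya yj => bnd i y (face y ya yj)).
  apply: (cauchy_unique Hw lam0 (i := i) (a := a)) => y ya.
    by rewrite mirror_fix// u0// !mulr0 addr0.
  rewrite (dirD_lin _ _ _ _ Hu.1 Hm.1) (dirD_mirror _ _ _ Hu.1) mirror_fix//.
  by rewrite mul1r opprK mul1r subrr.
- have bnd' y : onFace l i y -> dirD (e i) u y = 0.
    by move=> /bnd; rewrite dirD.unlock.
  have u0 := zero_hyperplane (helm_dirD (e i) Hu) lam0 l0
     (fun y ya yj => bnd' y (face y ya yj)).
  apply: (cauchy_unique Hw lam0 (i := i) (a := a)) => y ya.
    by rewrite mirror_fix// mul1r mulN1r subrr.
  rewrite (dirD_lin _ _ _ _ Hu.1 Hm.1) (dirD_mirror _ _ _ Hu.1) mirror_fix//.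
  by rewrite u0// oppr0 !mulr0 addr0.
Qed.

Definition periodic_in f i (T : R) := forall x, f (x + T *: e i) = f x.

(** Reflecting in two opposite faces is a translation by twice the side, and the two equal signs
    cancel. *)
Lemma eigsp_periodic bc l lam u i : (forall j, 0 < side l j) -> 0 <= lam ->
  eigsp bc l lam u -> periodic_in u i (2 * side l i).
Proof.
move=> l0 lam0 Eu x.
have E0 := eigsp_mirror l0 lam0 Eu (or_introl (erefl 0) : 0 = 0 \/ 0 = side l i).
have E1 := eigsp_mirror l0 lam0 Eu (or_intror (erefl _) : side l i = 0 \/ side l i = side l i).
have -> : x + (2 * side l i) *: e i = mirror i (side l i) (mirror i 0 x).
  apply/rowP => j; rewrite /mirror !mxE !eqxx.
  by case: (j == i) => /=; ring.
by rewrite E1 E0 mulrA; case: (bc); rewrite /= ?mulrNN mul1r ?mul1r.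
Qed.

Lemma periodic_nat f i T n x : periodic_in f i T -> f (x + (n%:R * T) *: e i) = f x.
Proof.
move=> fT; elim: n => [|n IH]; first by rewrite mul0r scale0r addr0.
by rewrite -natr1 mulrDl mul1r scalerDl addrA fT.
Qed.

Lemma periodic_int f i T (n : int) x : periodic_in f i T ->
  f (x + (n%:~R * T) *: e i) = f x.
Proof.
move=> fT; case: n => n; first exact: periodic_nat.
rewrite NegzE mulrNz mulNr scaleNr -[in RHS](subrK ((n.+1%:~R * T) *: e i) x).
by rewrite -(periodic_nat n.+1 (x - _) fT).
Qed.

Lemma periodic_bounded f (L : 'I_d -> R) : continuous f -> (forall i, 0 < L i) ->
  (forall i, periodic_in f i (L i)) -> exists M, forall x, `|f x| <= M.
Proof.
move=> cf L0 fL.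
pose rho := \sum_i L i.
have Lrho j : L j <= rho.
  by rewrite /rho (bigD1 j)//= lerDl; apply: sumr_ge0 => i _; exact: ltW.
have [M _ MP] := continuous_bounded_cube 0 rho cf.
exists M => x.
suff H (s : seq 'I_d) : exists y, f y = f x /\ forall j, j \in s -> `|y 0 j| <= rho.
  have [y [<- yP]] := H (enum 'I_d); apply: MP => j.
  by rewrite mxE subr0; apply: yP; rewrite mem_enum.
elim: s => [|j s [y [yx ys]]]; first by exists x.
(* Subtracting n periods brings the j-th coordinate into [0, L j) and leaves the treated ones
   bounded. *)
pose n := Num.floor (y 0 j / L j).
exists (y + ((- n)%:~R * L j) *: e j); split; first by rewrite periodic_int.
have yE k : (y + ((- n)%:~R * L j) *: e j) 0 k =
    y 0 k - (n%:~R * L j) * (j == k)%:R by rewrite -evecE !mxE mulrNz !mulNr.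
move=> k; rewrite inE yE => /orP[/eqP ->|ks].
  rewrite eqxx mulr1.
  have := floor_itv (y 0 j / L j); rewrite -/n => /andP[n1 n2].
  have b1 : 0 <= y 0 j - n%:~R * L j by rewrite subr_ge0 -ler_pdivlMr.
  have b2 : y 0 j - n%:~R * L j <= L j.
    rewrite lerBlDr -[X in X + _]mul1r -mulrDl -ler_pdivrMr// addrC.
    by move: n2; rewrite intrD => /ltW.
  by rewrite ger0_norm// (le_trans b2).
case: (eqVneq j k) => [jk|_]; last by rewrite mulr0 subr0 ys.
rewrite -jk mulr1.
have := floor_itv (y 0 j / L j); rewrite -/n => /andP[n1 n2].
have b1 : 0 <= y 0 j - n%:~R * L j by rewrite subr_ge0 -ler_pdivlMr.
have b2 : y 0 j - n%:~R * L j <= L j.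
  rewrite lerBlDr -[X in X + _]mul1r -mulrDl -ler_pdivrMr// addrC.
  by move: n2; rewrite intrD => /ltW.
by rewrite ger0_norm// (le_trans b2).
Qed.

Definition bounded_by f (M : R) := forall x, `|f x| <= M.

Lemma dirD_bounded lam f i M : helm lam f -> 0 <= lam -> bounded_by f M ->
  bounded_by (dirD (e i) f) ((d%:R + lam) * M).
Proof.
move=> Hf lam0 fM x.
apply: le_trans (interior_gradient i Hf lam0 ltr01 (M := M) _) _.
  by move=> y _; exact: fM.
have M0 : 0 <= M := le_trans (normr_ge0 _) (fM x).
by rewrite ler_wpM2r// divr1 mulr1 lerD2l; move: lam0; lra.
Qed.

(* S and C play the roles of sin (k t) / k and cos (k t), with k = 0 allowed.
   Rolle's theorem for F' S(h - s) + F C(h - s), with F s the defect of the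
   symmetric difference at scale s, gives r(x + s) + r(x - s) = 0 for some s < h,
   where r = D^2 f + k^2 f; since |D r| <= C0 sup |r|, this forces r = 0. *)
Lemma mode_equation lam f i (M h k2 : R) (S C : R -> R) : helm lam f -> 0 <= lam ->
  bounded_by f M -> 0 < h -> h * (d%:R + lam) <= 2^-1 ->
  (forall t : R, is_derive t 1 S (C t)) ->
  (forall t : R, is_derive t 1 C (- k2 * S t)) ->
  S 0 = 0 -> C 0 = 1 -> (forall t, 0 < t < h -> 0 < S t) ->
  (forall x, f (x + h *: e i) + f (x - h *: e i) = 2 * C h * f x) ->
  forall x, dirD (e i) (dirD (e i) f) x = - k2 * f x.
Proof.
move=> Hf lam0 fM h0 hK dS dC S0 C0 Spos fC.
pose r x := 1 * dirD (e i) (dirD (e i) f) x + k2 * f x.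
have H1 := helm_dirD (e i) Hf; have H2 := helm_dirD (e i) H1.
have Hr : helm lam r := helm_lin 1 k2 H2 Hf.
suff r0 : forall x, r x = 0.
  by move=> x; apply/eqP; have := r0 x; rewrite /r mul1r => /eqP; rewrite addr_eq0 mulNr.
have rolle x : exists s, [/\ 0 < s, s < h & r (x + s *: e i) + r (x - s *: e i) = 0].
  have dn g (t : R) : smooth g -> is_derive t 1 (fun s : R => g (x - s *: e i))
      (- dirD (e i) g (x - t *: e i)).
    move=> sg; have := is_derive_line x (- e i) t sg.
    rewrite -scaleN1r dirD_scalev// mulN1r scaleN1r scalerN.
    by under eq_fun do rewrite scalerN.
  have dp g (t : R) sg := is_derive_line (f := g) x (e i) t sg.
  pose F (s : R) := f (x + s *: e i) + f (x - s *: e i) - 2 * f x * C s.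
  pose F1 (s : R) := dirD (e i) f (x + s *: e i) - dirD (e i) f (x - s *: e i)
              - 2 * f x * (- k2 * S s).
  pose F2 (s : R) := dirD (e i) (dirD (e i) f) (x + s *: e i)
                 + dirD (e i) (dirD (e i) f) (x - s *: e i)
              - 2 * f x * (- k2 * C s).
  have dF (t : R) : is_derive t 1 F (F1 t).
    exact: is_derive_sub (is_derive_add (dp _ _ Hf.1) (dn _ _ Hf.1))
      (is_derive_scale (2 * f x) (dC t)).
  have dF1 (t : R) : is_derive t 1 F1 (F2 t).
    have := is_derive_sub (is_derive_sub (dp _ t H1.1) (dn _ t H1.1))
      (is_derive_scale (2 * f x) (is_derive_scale (- k2) (dS t))).
    by rewrite opprK.
  have dh (t : R) : is_derive t 1 (fun s : R => h - s) (0 - 1).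
    exact: is_derive_sub (is_derive_const _ _ _) (is_derive_id _ _).
  have dSh (t : R) : is_derive t 1 (fun s : R => S (h - s)) (C (h - t) * (0 - 1)).
    exact: is_derive_chain.
  have dCh (t : R) : is_derive t 1 (fun s : R => C (h - s)) (- k2 * S (h - t) * (0 - 1)).
    exact: is_derive_chain.
  pose W (s : R) := F1 s * S (h - s) + F s * C (h - s).
  have dW (t : R) : is_derive t 1 W
      (F1 t * (C (h - t) * (0 - 1)) + F2 t * S (h - t) +
       (F t * (- k2 * S (h - t) * (0 - 1)) + F1 t * C (h - t))).
    by apply: is_derive_add; apply: is_derive_mul.
  have [s [s0 sh E]] := mvt_itv h0 dW.
  exists s; split => //.
  have Wh : W h = 0.
    rewrite /W subrr S0 mulr0 add0r /F fC C0 mulr1.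
    by rewrite [2 * C h * _]mulrAC subrr.
  have W0 : W 0 = 0.
    rewrite /W /F /F1 !scale0r !subr0 !addr0 C0 S0 !mulr0 !subr0 subrr mul0r add0r.
    by rewrite mulr1 mulr_natl mulr2n subrr mul0r.
  move: E; rewrite Wh W0 !subr0 => /esym/eqP.
  rewrite mulf_eq0 [h == 0]gt_eqF// orbF => /eqP E.
  have Sp : S (h - s) != 0.
    by rewrite gt_eqF// Spos// subr_gt0 sh /= ltrBlDr ltrDl.
  apply: (mulIf Sp); rewrite mul0r -E /r /F2 /F.
  move: (F1 s) (S (h - s)) (C (h - s)) (C s) (f _) (f _) (f x) => a1 a2 a3 a4 a5 a6 a7.
  by move: (dirD _ _ _) (dirD _ _ _) => a8 a9; ring.
have contract B : bounded_by r B -> bounded_by r (B * 2^-1).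
  move=> rB x; have [s [s0 sh E]] := rolle x.
  have rD := dirD_bounded i Hr lam0 rB.
  have B0 : 0 <= B := le_trans (normr_ge0 _) (rB x).
  have [t1 [t10 t1s E1]] := mvt_line x (e i) Hr.1 s0.
  have [t2 [t20 t2s E2]] := mvt_line (x - s *: e i) (e i) Hr.1 s0.
  rewrite subrK in E2.
  have e1 := rD (x + t1 *: e i); have e2 := rD (x - s *: e i + t2 *: e i).
  have E3 : 2 * r x = dirD (e i) r (x - s *: e i + t2 *: e i) * s -
      dirD (e i) r (x + t1 *: e i) * s.
    rewrite -E1 -E2; move: E; move: (r _) (r _) (r x) => a1 a2 a3 a12.
    by rewrite -[a2]opprK -(addr0_eq a12); ring.
  have hB : s * ((d%:R + lam) * B) <= B * 2^-1.
    apply: (@le_trans _ _ (h * ((d%:R + lam) * B))).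
      by rewrite ler_wpM2r ?(ltW sh)// mulr_ge0// addr_ge0.
    by rewrite mulrA mulrC ler_wpM2l.
  have : `|2 * r x| <= 2 * (B * 2^-1).
    rewrite E3 mulr_natl mulr2n; apply: le_trans (ler_normB _ _) _.
    by apply: lerD; rewrite normrM [`|s|]gtr0_norm// mulrC;
      apply: le_trans hB; rewrite ler_wpM2l// ltW.
  by rewrite normrM ger0_norm// ler_pM2l.
pose B := (d%:R + lam) * ((d%:R + lam) * M) + `|k2| * M.
have rB : bounded_by r B.
  move=> x; rewrite /r mul1r; apply: le_trans (ler_normD _ _) _.
  apply: lerD; first exact: (dirD_bounded i H1 lam0 (dirD_bounded i Hf lam0 fM)).
  by rewrite normrM ler_wpM2l.
have rn n : bounded_by r (B * 2^-1 ^+ n).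
  elim: n => [|n IH]; first by rewrite expr0 mulr1.
  by rewrite exprSr mulrA; exact: contract.
by move=> x; apply/eqP; rewrite -normr_le0; apply: (@le0_of_geometric _ _ B) => n _; exact: rn.
Qed.

End PeriodicSolutions.

(** * Trigonometric decomposition *)
Section TrigonometricSums.
Context {R : realType}.

Lemma cos_add_2pin (x : R) n : cos (x + n%:R * (2 * pi)) = cos x.
Proof.
have := periodicn (@cosD2pi R) n x.
by rewrite -[pi *+ 2 *+ n]mulr_natl -[pi *+ 2]mulr_natl.
Qed.

Lemma sin_add_2pin (x : R) n : sin (x + n%:R * (2 * pi)) = sin x.
Proof.
have := periodicn (@sinD2pi R) n x.
by rewrite -[pi *+ 2 *+ n]mulr_natl -[pi *+ 2]mulr_natl.
Qed.

(** Orthogonality of roots of unity in real form: multiplied by 2 sin(phi/2), which is nonzero as 0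
    < phi/2 < pi, the sum telescopes over a full period. *)
Lemma sum_cos_roots (N k : nat) : (k < N)%N ->
  \sum_(0 <= m < N) cos (k%:R * m%:R * (2 * pi / N%:R)) = (if k == 0%N then N%:R else 0) :> R.
Proof.
case: eqVneq => [-> _|k0 kN].
  rewrite (eq_bigr (fun=> 1)) => [|m _]; last by rewrite !mul0r cos0.
  by rewrite sumr_const_nat subn0.
have N0 : N%:R != 0 :> R by rewrite pnatr_eq0 -lt0n; apply: leq_ltn_trans kN.
pose phi : R := k%:R * (2 * pi / N%:R).
have phi2 : 0 < phi / 2 < pi.
  have -> : phi / 2 = k%:R / N%:R * pi by rewrite /phi; field.
  have k0' : 0 < k%:R :> R by rewrite ltr0n lt0n.
  have NP : 0 < N%:R :> R by rewrite ltr0n; apply: leq_ltn_trans kN.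
  rewrite mulr_gt0 ?divr_gt0 ?pi_gt0//=.
  by rewrite gtr_pMl ?pi_gt0// ltr_pdivrMr// mul1r ltr_nat.
have sphi : sin (phi / 2) != 0 by rewrite gt_eqF// sin_gt0_pi.
have s2 : 2 * sin (phi / 2) != 0 by rewrite mulf_neq0.
apply: (mulfI s2); rewrite mulr0 big_distrr /=.
rewrite (@telescope_sumr_eq _ 0 N (fun m => sin (m%:R * phi - phi / 2)))//.
  have -> : N%:R * phi - phi / 2 = - (phi / 2) + k%:R * (2 * pi) by rewrite /phi; field.
  by rewrite sin_add_2pin mul0r sub0r subrr.
move=> m _.
have -> : m.+1%:R * phi - phi / 2 = m%:R * phi + phi / 2 by rewrite -natr1; field.
have -> : k%:R * m%:R * (2 * pi / N%:R) = m%:R * phi by rewrite /phi; ring.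
rewrite sinD sinB; move: (sin _) (sin _) (cos _) (cos _) => a1 a2 a3 a4; ring.
Qed.

Lemma sum_shift (b : nat -> R) N : b N = b 0%N ->
  \sum_(0 <= k < N) b k.+1 = \sum_(0 <= k < N) b k.
Proof.
case: N => [|N] bN; first by rewrite !big_geq.
by rewrite big_nat_recr//= bN [in RHS]big_nat_recl//= addrC.
Qed.

Lemma cos_two_term (a th : R) : cos (a - th) + cos (a + th) = 2 * cos th * cos a.
Proof. by rewrite cosB cosD; move: (cos a) (sin a) (cos th) (sin th) => *; ring. Qed.

(** Cyclic summation by parts moves the shifts of U onto the cosine weights, which satisfy the
    recurrence themselves. Indices k, k+1, k+2 avoid negative ones. *)
Lemma cos_recurrence (U : nat -> R) (N m : nat) : (0 < N)%N ->
  (forall k, U (k + N)%N = U k) -> let th := m%:R * (2 * pi / N%:R) in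
  \sum_(0 <= k < N) cos (k%:R * th) * U k.+2 + \sum_(0 <= k < N) cos (k%:R * th) * U k =
  2 * cos th * \sum_(0 <= k < N) cos (k%:R * th) * U k.+1.
Proof.
move=> N0 UN th.
have NR : N%:R != 0 :> R by rewrite pnatr_eq0 -lt0n.
have Nth : N%:R * th = m%:R * (2 * pi) by rewrite /th; field.
have E1 : \sum_(0 <= k < N) cos (k%:R * th) * U k.+2 =
          \sum_(0 <= k < N) cos (k%:R * th - th) * U k.+1.
  rewrite -(sum_shift (b := fun k => cos (k%:R * th - th) * U k.+1)).
    by apply: eq_bigr => k _; rewrite -natr1 mulrDl mul1r addrK.
  by rewrite -addn1 addnC UN Nth mul0r sub0r addrC cos_add_2pin.
have E2 : \sum_(0 <= k < N) cos (k%:R * th) * U k =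
          \sum_(0 <= k < N) cos (k%:R * th + th) * U k.+1.
  rewrite -(sum_shift (b := fun k => cos (k%:R * th) * U k)).
    by apply: eq_bigr => k _; rewrite -natr1 mulrDl mul1r.
  rewrite -[in LHS](add0n N) UN add0n Nth mul0r; congr (_ * _).
  by rewrite -[X in cos X]add0r cos_add_2pin.
rewrite E1 E2 -big_split big_distrr /=; apply: eq_bigr => k _.
by rewrite -mulrDl cos_two_term mulrA.
Qed.

(** Supplies the pair S, C of [mode_equation]. The bound n h <= L says w h <= pi, which keeps the
    sine positive on (0, h); for n = 0 the limit S t = t replaces sin(w t)/w. *)
Lemma harmonic_pair (n : nat) (L h : R) : 0 < L -> 0 < h -> n%:R * h <= L ->
  let w := pi * n%:R / L in
  exists S, [/\ forall t : R, is_derive t 1 S (cos (w * t)),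
    forall t : R, is_derive t 1 (fun t : R => cos (w * t)) (- w ^+ 2 * S t), S 0 = 0 &
    forall t : R, 0 < t < h -> 0 < S t].
Proof.
move=> L0 h0 nh w.
have dw (t : R) : is_derive t 1 (fun t : R => w * t) (w * 1).
  exact: is_derive_scale (is_derive_id _ _).
have [n0|n0] := posnP n.
  have w0 : w = 0 by rewrite /w n0 mulr0 mul0r.
  exists id; split => [t|t||t /andP[]]//.
  - rewrite w0 mul0r cos0; exact: is_derive_id.
  - rewrite w0 expr0n oppr0 mul0r; under eq_fun do rewrite mul0r cos0.
    exact: is_derive_const.
have w0 : 0 < w by rewrite divr_gt0// mulr_gt0 ?pi_gt0// ltr0n.
exists (fun t => w^-1 * sin (w * t)); split => [t|t||t /andP[t0 th]].
- have -> : cos (w * t) = w^-1 * (cos (w * t) * (w * 1)).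
    by rewrite mulr1 mulrCA mulVf ?mulr1// gt_eqF.
  by apply: is_derive_scale; exact: (is_derive_chain (is_derive_sin _) (dw t)).
- have -> : - w ^+ 2 * (w^-1 * sin (w * t)) = - sin (w * t) * (w * 1).
    by field; rewrite gt_eqF.
  exact: (is_derive_chain (is_derive_cos _) (dw t)).
- by rewrite mulr0 sin0 mulr0.
- rewrite mulr_gt0 ?invr_gt0// sin_gt0_pi// mulr_gt0//=.
  apply: (@lt_le_trans _ _ (w * h)); first by rewrite ltr_pM2l.
  rewrite /w mulrAC ler_pdivrMr// -mulrA ler_pM2l//; exact: pi_gt0.
Qed.

End TrigonometricSums.

(** * Discrete Fourier projections and joint modes *)

Section Decomposition.
Context {R : realType} {d : nat}.
Notation V := 'rV[R]_d.
Notation e := (@evec R d).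
Implicit Types (f g h u : V -> R) (x v : V) (i j : 'I_d) (lam : R).

(** Discrete convolutions commute with derivatives and preserve equation, periods, boundedness and
    the modes in other directions, so splitting along one coordinate does not spoil the splittings
    already made. *)
Definition translates (N : nat) (a : nat -> R) (w : nat -> V) f : V -> R :=
  fun x => \sum_(0 <= k < N) a k * f (x + w k).

Lemma helm_translates lam N a w f : helm lam f -> helm lam (translates N a w f).
Proof. by move=> Hf; apply: helm_sum => k; apply: helm_scale; exact: helm_shift. Qed.

Lemma dirD_translates lam N a w f v : helm lam f ->
  dirD v (translates N a w f) = translates N a w (dirD v f).
Proof.
move=> Hf; apply/funext => x; apply: dirD_val; apply: is_derive_bigsum => k.
apply: is_derive_scale; have Hk := helm_shift (w k) Hf.
have := smooth_is_derive x v Hk.1.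
by rewrite (dirD_affine _ _ Hf.1 (affine_shift (w k))).
Qed.

Definition mode f i (L : R) (n : nat) :=
  forall x, dirD (e i) (dirD (e i) f) x = - (pi * n%:R / L) ^+ 2 * f x.

Lemma translates_mode lam N a w f i L n : helm lam f -> mode f i L n ->
  mode (translates N a w f) i L n.
Proof.
move=> Hf fm x.
rewrite (dirD_translates _ _ _ _ Hf) (dirD_translates _ _ _ _ (helm_dirD (e i) Hf)).
rewrite /translates big_distrr /=; apply: eq_bigr => k _.
by rewrite fm mulrCA.
Qed.

Lemma translates_periodic N a w f i T : periodic_in f i T ->
  periodic_in (translates N a w f) i T.
Proof.
by move=> fT x; apply: eq_bigr => k _; rewrite addrAC fT.
Qed.

Lemma translates_bounded N a w f M : bounded_by f M ->
  exists M', bounded_by (translates N a w f) M'.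
Proof.
move=> fM; exists (\sum_(0 <= k < N) `|a k| * M) => x.
apply: le_trans (ler_norm_sum _ _ _) _; apply: ler_sum => k _.
by rewrite normrM ler_wpM2l.
Qed.

Lemma mode_decomposition lam u i (L M : R) : helm lam u -> 0 <= lam ->
  bounded_by u M -> 0 < L -> periodic_in u i (2 * L) ->
  exists N (a : nat -> nat -> R) w (n : nat -> nat),
    (forall x, u x = \sum_(0 <= m < N) translates N (a m) w u x) /\
    (forall m, (m < N)%N -> mode (translates N (a m) w u) i L (n m)).
Proof.
move=> Hu lam0 uM L0 uT.
pose K : R := d%:R + lam; have K0 : 0 <= K by rewrite addr_ge0.
(* N exceeds 4 L K, so the grid step h = 2 L/N satisfies h K <= 1/2, the smallness asked for by
   [mode_equation]. *)
pose N := (Num.truncn (4 * L * K)).+1.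
have NP : (0 < N)%N by [].
have NR : 0 < N%:R :> R by rewrite ltr0n.
have NR0 : N%:R != 0 :> R by rewrite gt_eqF.
pose h := 2 * L / N%:R; have h0 : 0 < h by rewrite divr_gt0// mulr_gt0.
have hK : h * K <= 2^-1.
  have -> : h * K = 4 * L * K / N%:R * 2^-1 by rewrite /h; field.
  rewrite -[leRHS]mul1r ler_wpM2r// ler_pdivrMr// mul1r ltW//.
  exact: truncnS_gt.
pose th m : R := m%:R * (2 * pi / N%:R).
pose a (m k : nat) : R := N%:R^-1 * cos (k%:R * th m).
pose w (k : nat) : V := (k%:R * h) *: e i.
(* Indices m and N - m give the same cosine on the grid; the smaller one is the true frequency,
   since it satisfies n h <= L. *)
pose n m := minn m (N - m).
exists N, a, w, n; split.
  have Sa k : (k < N)%N -> \sum_(0 <= m < N) a m k = (k == 0%N)%:R.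
    move=> kN; rewrite /a -big_distrr /=.
    under eq_bigr do rewrite /th mulrA.
    by rewrite sum_cos_roots//; case: eqVneq => _; rewrite ?mulVf ?mulr0.
  move=> x; rewrite /translates exchange_big_nat /=.
  rewrite (eq_big_nat _ _ (F2 := fun k => (k == 0%N)%:R * u (x + w k))); last first.
    by move=> k /andP[_ kN]; rewrite -big_distrl /= Sa.
  rewrite big_ltn// big_nat big1 ?addr0 => [|k /andP[k1 _]]; last first.
    by rewrite (gtn_eqF k1) mul0r.
  by rewrite /w mul0r scale0r addr0 mul1r.
move=> m mN.
have nh : (n m)%:R * h <= L.
  have nN : (2 * n m <= N)%N.
    rewrite mul2n -addnn; apply: leq_trans (leq_add (geq_minl _ _) (geq_minr _ _)) _.
    by rewrite subnKC// ltnW.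
  have -> : (n m)%:R * h = (2 * n m)%:R * L / N%:R by rewrite natrM /h; ring.
  by rewrite ler_pdivrMr// mulrC ler_wpM2l ?(ltW L0)// ler_nat.
have wh : pi * (n m)%:R / L * h = (n m)%:R * (2 * pi / N%:R).
  by rewrite /h; field; rewrite NR0 gt_eqF.
have [S [dS dC S0 Spos]] := harmonic_pair L0 h0 nh.
have Hf := helm_translates N (a m) w Hu.
have [M' fM'] := translates_bounded N (a m) w uM.
apply: (mode_equation Hf lam0 fM' h0 hK dS dC S0) => //.
  by rewrite mulr0 cos0.
move=> x; rewrite wh.
have -> : cos ((n m)%:R * (2 * pi / N%:R)) = cos (th m).
  rewrite /n; case: (leqP m (N - m)) => mm; first by [].
  rewrite natrB ?(ltnW mN)// /th.
  have -> : (N%:R - m%:R) * (2 * pi / N%:R) =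
     - (m%:R * (2 * pi / N%:R)) + 1%:R * (2 * pi) :> R.
    by rewrite mulrBl [N%:R * _]mulrC divfK// addrC mul1r.
  by rewrite cos_add_2pin cosN.
(* Starting one grid step to the left makes the values at x - h e_i, x and x + h e_i the shifts by
   0, 1 and 2 of one N-periodic sequence. *)
pose U k := u (x - h *: e i + w k).
have UN k : U (k + N)%N = U k.
  rewrite /U -[RHS](uT (_ + w k)) -[in RHS]addrA; congr (u (_ + _)).
  rewrite /w -scalerDl natrD mulrDl; congr ((_ + _) *: _).
  by rewrite /h mulrC divfK.
have R1 := cos_recurrence m NP UN; rewrite /= -/(th m) in R1.
have T0 : translates N (a m) w u (x - h *: e i) =
   N%:R^-1 * \sum_(0 <= k < N) cos (k%:R * th m) * U k.
  by rewrite /translates big_distrr /=; apply: eq_bigr => k _; rewrite mulrA.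
have wS k : w k.+1 = h *: e i + w k.
  by rewrite /w -natr1 mulrDl mul1r scalerDl addrC.
have T1 : translates N (a m) w u x =
   N%:R^-1 * \sum_(0 <= k < N) cos (k%:R * th m) * U k.+1.
  rewrite /translates big_distrr /=; apply: eq_bigr => k _.
  by rewrite mulrA /U wS addrA subrK.
have T2 : translates N (a m) w u (x + h *: e i) =
   N%:R^-1 * \sum_(0 <= k < N) cos (k%:R * th m) * U k.+2.
  rewrite /translates big_distrr /=; apply: eq_bigr => k _.
  by rewrite mulrA /U !wS addrA subrK addrA.
by rewrite T0 T1 T2 -mulrDr R1 mulrCA.
Qed.

Definition pop (w : 'I_d -> R) f x := \sum_i w i * dirD (e i) (dirD (e i) f) x.

Lemma pop_sum lam w f {I : Type} (r : seq I) (F : I -> V -> R) x :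
  (forall i : I, helm lam (F i)) -> (forall x, f x = \sum_(k <- r) F k x) ->
  pop w f x = \sum_(k <- r) pop w (F k) x.
Proof.
move=> HF fE; have -> : f = fun x => \sum_(k <- r) F k x by apply/funext.
rewrite /pop exchange_big /=; apply: eq_bigr => i _.
rewrite -big_distrr /=; congr (_ * _).
have -> : dirD (e i) (fun x => \sum_(k <- r) F k x) =
   fun x => \sum_(k <- r) dirD (e i) (F k) x.
  by apply/funext => y; apply: dirD_sum => k; exact: (HF k).1.
by apply: dirD_sum => k; exact: (helm_dirD (e i) (HF k)).1.
Qed.

(** Induction on the list [s] of directions not yet split into modes; P is linear and mu is common
    to all pieces, so the pieces may be added up again. *)
Lemma periodic_eigenfunction lam (L w : 'I_d -> R) (mu : R) f : 0 <= lam ->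
  (forall i, 0 < L i) ->
  (forall n : 'I_d -> nat, \sum_i (pi * (n i)%:R / L i) ^+ 2 = lam ->
     \sum_i w i * (pi * (n i)%:R / L i) ^+ 2 = mu) ->
  helm lam f -> (exists M, bounded_by f M) -> (forall i, periodic_in f i (2 * L i)) ->
  forall x, pop w f x = - mu * f x.
Proof.
move=> lam0 L0 spec.
suff H (s : seq 'I_d) g : helm lam g -> (exists M, bounded_by g M) ->
    (forall i, periodic_in g i (2 * L i)) ->
    (forall j, j \notin s -> exists n, mode g j (L j) n) ->
    forall x, pop w g x = - mu * g x.
  move=> Hf fM fL; apply: (H (enum 'I_d)) => // j; by rewrite mem_enum.
elim: s g => [|j s IH] g Hg [M gM] gL gmode x.
  have [n nP] : exists n : 'I_d -> nat, forall j, mode g j (L j) (n j).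
    have /choice[n nP] : forall j, exists n, mode g j (L j) n by move=> j; exact: gmode.
    by exists n.
  have E : pop w g x = - (\sum_i w i * (pi * (n i)%:R / L i) ^+ 2) * g x.
    rewrite mulNr big_distrl -sumrN /=; apply: eq_bigr => i _.
    by rewrite nP mulNr mulrN mulrA.
  (* Where g x is nonzero, the Helmholtz equation at x can be divided by it and says that the
     squared frequencies sum to lam, which is the premise of [spec]. *)
  have [g0|g0] := eqVneq (g x) 0; first by rewrite E g0 !mulr0.
  rewrite E spec//; apply/eqP; rewrite -subr_eq0 -oppr_eq0 opprB.
  rewrite -(mulIr_eq0 _ (mulIf g0)) mulrBl; apply/eqP.
  rewrite -[RHS](Hg.2 x) addrC lapE; congr (_ + _).
  rewrite big_distrl -sumrN /=; apply: eq_bigr => i _.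
  by rewrite nP mulNr.
have [N [a [v [n [gE gn]]]]] := mode_decomposition Hg lam0 gM (L0 j) (gL j).
have Ht m : helm lam (translates N (a m) v g) by exact: helm_translates.
rewrite (pop_sum w x Ht gE) gE big_distrr /=.
rewrite !big_nat; apply: eq_bigr => m /andP[_ mN].
apply: IH => //.
- exact: translates_bounded gM.
- by move=> i; apply: translates_periodic.
move=> k ks; have [->|kj] := eqVneq k j; first by exists (n m); exact: gn.
have [|q qP] := gmode k; first by rewrite inE negb_or kj.
by exists q; exact: translates_mode Hg qP.
Qed.

End Decomposition.

(** * Separation by a second-order operator *)
Section RationalFunctional.
Context {R : realType}.

(* Graphs of Q-linear maps defined on a Q-subspace of R. *)
Record rat_graph (G : R -> R -> Prop) : Prop := {
  rat_graph0 : G 0 0;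
  rat_graphD : forall x y x' y', G x y -> G x' y' -> G (x + x') (y + y');
  rat_graphZ : forall (t : rat) x y, G x y -> G (ratr t * x) (ratr t * y);
  rat_graph_fun : forall y, G 0 y -> y = 0 }.

(** A number outside the domain may be sent to 0; the extension is single-valued since x' + t a = 0
    with t nonzero would put a in the domain. Finitely many numbers are concerned, so no maximality
    argument enters. *)
Lemma rat_graph_extend G a : rat_graph G ->
  exists G', [/\ rat_graph G', forall x y, G x y -> G' x y & exists y, G' a y].
Proof.
move=> GG; have [[y Gy]|na] := pselect (exists y, G a y).
  by exists G; split => //; exists y.
exists (fun x y => exists (t : rat) x', G x' y /\ x = x' + ratr t * a); split.
- split.
  + by exists 0, 0; rewrite rmorph0 mul0r addr0; split => //; exact: rat_graph0.
  + move=> x y x' y' [t [z [Gz ->]]] [t' [z' [Gz' ->]]].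
    exists (t + t'), (z + z'); split; first exact: rat_graphD.
    by rewrite rmorphD mulrDl addrACA.
  + move=> s x y [t [z [Gz ->]]]; exists (s * t), (ratr s * z); split.
      exact: rat_graphZ.
    by rewrite rmorphM mulrDr mulrA.
  + move=> y [t [z [Gz /esym/eqP]]]; rewrite addr_eq0 => /eqP zE.
    have [t0|t0] := eqVneq t 0.
      by move: Gz; rewrite zE t0 rmorph0 mul0r oppr0; exact: rat_graph_fun.
    case: na; exists (ratr (- t^-1) * y).
    have := rat_graphZ GG (- t^-1) Gz; rewrite zE mulrN !rmorphN mulNr opprK mulrA.
    by rewrite -rmorphM/= mulVf// rmorph1 mul1r.
- by move=> x y Gxy; exists 0, x; rewrite rmorph0 mul0r addr0.
- by exists 0, 1, 0; rewrite rmorph1 mul1r add0r; split => //; exact: rat_graph0.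
Qed.

Lemma rat_graph_extend_seq G (s : seq R) : rat_graph G ->
  exists G', [/\ rat_graph G', forall x y, G x y -> G' x y &
                 forall a, a \in s -> exists y, G' a y].
Proof.
move=> GG; elim: s => [|a s [G1 [GG1 sub1 ex1]]]; first by exists G.
have [G2 [GG2 sub2 [y Gy]]] := rat_graph_extend a GG1.
exists G2; split => // [x z /sub1/sub2//|b].
rewrite inE => /orP[/eqP ->|/ex1[z /sub2 Gz]]; first by exists y.
by exists z.
Qed.

(** The starting functional s + t al -> t on Q + Q al; irrationality of al is precisely its
    single-valuedness. *)
Lemma rat_graph_irrational (al : R) : (forall t : rat, al <> ratr t) ->
  rat_graph (fun x y => exists s t : rat, x = ratr s + ratr t * al /\ y = ratr t).
Proof.
move=> irr; split.
- by exists 0, 0; rewrite !rmorph0 mul0r addr0.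
- move=> _ _ _ _ [s [t [-> ->]]] [s' [t' [-> ->]]].
  by exists (s + s'), (t + t'); rewrite !rmorphD/= mulrDl addrACA.
- move=> p _ _ [s [t [-> ->]]].
  by exists (p * s), (p * t); rewrite !rmorphM/= mulrDr mulrA.
- move=> _ [s [t [/esym/eqP E ->]]].
  have [->|t0] := eqVneq t 0; first by rewrite rmorph0.
  case: (irr (- (s / t))).
  have rt0 : ratr t != 0 :> R by rewrite fmorph_eq0.
  apply: (mulfI rt0); rewrite rmorphN/= fmorph_div/= mulrN mulrCA divff// mulr1.
  by move: E; rewrite addrC addr_eq0 => /eqP.
Qed.

(** The last clause is the trace of Q-linearity that the spectrum needs: squared frequencies enter
    as natural coefficients. *)
Lemma rational_functional (I : finType) (a : I -> R) (i0 j0 : I) :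
  a i0 = 1 -> (forall t : rat, a j0 <> ratr t) ->
  exists q : I -> R, [/\ q i0 = 0, q j0 = 1 & forall m m' : I -> nat,
    \sum_i (m i)%:R * a i = \sum_i (m' i)%:R * a i ->
    \sum_i (m i)%:R * q i = \sum_i (m' i)%:R * q i].
Proof.
move=> a1 irr.
have [G [GG sub ex]] := rat_graph_extend_seq [seq a i | i <- enum I] (rat_graph_irrational irr).
have /choice[q qP] : forall i, exists y, G (a i) y.
  by move=> i; apply: ex; apply: map_f; rewrite mem_enum.
have uniq x y y' : G x y -> G x y' -> y = y'.
  move=> g1 g2; have := rat_graphD GG g1 (rat_graphZ GG (-1) g2).
  by rewrite rmorphN1 !mulN1r subrr => /(rat_graph_fun GG)/eqP; rewrite subr_eq0 => /eqP.
have Gsum (m : I -> nat) : G (\sum_i (m i)%:R * a i) (\sum_i (m i)%:R * q i).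
  apply: (big_ind2 G); [exact: rat_graph0|exact: rat_graphD|move=> i _].
  by have := rat_graphZ GG (m i)%:R (qP i); rewrite ratr_nat.
exists q; split.
- apply: (uniq (a i0)) => //; apply: sub; exists 1, 0.
  by rewrite a1 rmorph1 !rmorph0 mul0r addr0.
- apply: (uniq (a j0)) => //; apply: sub; exists 0, 1.
  by rewrite rmorph1 !rmorph0 mul1r add0r.
- by move=> m m' E; apply: (uniq _ _ _ (Gsum m)); rewrite E.
Qed.

Lemma irrational_inv (y : R) : y \in @irrational R -> forall t : rat, y^-1 <> ratr t.
Proof.
rewrite inE => irr t E; apply: irr; exists t^-1 => //.
by apply: (can_inj invrK); rewrite fmorphV invrK; exact: esym E.
Qed.

End RationalFunctional.

(** * The separating operator and its two-point Wronskian *)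

Section Separation.
Context {R : realType} {d : nat}.
Notation V := 'rV[R]_d.
Notation e := (@evec R d).
Implicit Types (f g u : V -> R) (x y v : V) (i j : 'I_d) (lam : R).

(** With w_i = l_i^2 q_i the sides cancel: w_i (pi n_i/l_i)^2 = pi^2 n_i^2 q_i, whose sum is
    determined by the sum of the n_i^2/l_i^2. *)
Lemma separating_weights (l : 'I_d -> R) (j il : 'I_d) : (forall i, 0 < side l i) ->
  (val j < d.-1)%N -> l j ^+ 2 \in @irrational R -> val il = d.-1 ->
  exists w : 'I_d -> R, [/\ w il = 0, w j != 0 & forall lam, exists mu,
    forall n : 'I_d -> nat, \sum_i (pi * (n i)%:R / side l i) ^+ 2 = lam ->
      \sum_i w i * (pi * (n i)%:R / side l i) ^+ 2 = mu].
Proof.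
move=> l0 jd irr ild.
have sj : side l j = l j by rewrite /side (ltn_eqF jd).
have sil : side l il = 1 by rewrite /side ild eqxx.
have [|t|q [q0 q1 qP]] := @rational_functional R _ (fun i => (side l i ^+ 2)^-1) il j.
- by rewrite sil expr1n invr1.
- by rewrite sj; exact: irrational_inv.
exists (fun i => side l i ^+ 2 * q i); split.
- by rewrite q0 mulr0.
- by rewrite q1 mulr1 expf_neq0// gt_eqF.
move=> lam.
have E1 n : \sum_i (pi * (n i)%:R / side l i) ^+ 2 =
    pi ^+ 2 * \sum_i (n i ^ 2)%:R * (side l i ^+ 2)^-1.
  rewrite big_distrr; apply: eq_bigr => i _ /=.
  by rewrite natrX; field; rewrite gt_eqF.
have E2 n : \sum_i side l i ^+ 2 * q i * (pi * (n i)%:R / side l i) ^+ 2 =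
    pi ^+ 2 * \sum_i (n i ^ 2)%:R * q i.
  rewrite big_distrr; apply: eq_bigr => i _ /=.
  by rewrite natrX; field; rewrite gt_eqF.
have [[n0 nP]|no] := pselect (exists n : 'I_d -> nat,
   \sum_i (pi * (n i)%:R / side l i) ^+ 2 = lam); last first.
  (* No frequency vector yields this lam, so any mu will do. *)
  by exists 0 => n nE; case: no; exists n.
exists (\sum_i side l i ^+ 2 * q i * (pi * (n0 i)%:R / side l i) ^+ 2) => n.
rewrite -nP !E1 !E2 => E; congr (_ * _); apply: qP; apply: mulfI E.
by rewrite expf_neq0// gt_eqF// pi_gt0.
Qed.

Lemma eigsp_pop bc (l w : 'I_d -> R) lam mu u : (forall i, 0 < side l i) -> 0 <= lam ->
  (forall n : 'I_d -> nat, \sum_i (pi * (n i)%:R / side l i) ^+ 2 = lam ->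
      \sum_i w i * (pi * (n i)%:R / side l i) ^+ 2 = mu) ->
  eigsp bc l lam u -> forall x, pop w u x = - mu * u x.
Proof.
move=> l0 lam0 spec Eu.
have uP i := eigsp_periodic i l0 lam0 Eu.
apply: (periodic_eigenfunction lam0 l0 spec (eigsp_helm Eu) _ uP).
apply: (periodic_bounded (L := fun i => 2 * side l i) (smooth_continuous Eu.1)) => // i.
by rewrite mulr_gt0.
Qed.

Lemma dirD_scaling u (z0 : V) (s : R) i : smooth u ->
  dirD (e i) (fun x => u (z0 + s *: x)) = fun x => s * dirD (e i) u (z0 + s *: x).
Proof.
move=> su; apply/funext => x; apply: dirD_val.
rewrite -(dirD_scalev _ _ _ su) [X in is_derive _ _ _ X](_ : _ = 'D_(s *: e i) u (z0 + s *: x)); last by rewrite dirD.unlock.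
apply: (@is_derive_affine R V V u (fun x => z0 + s *: x)).
  by move=> h; rewrite scalerDr addrCA !scalerA mulrC.
exact: smooth_derivable.
Qed.

Lemma pop_scaling w u (z0 : V) (s : R) x : smooth u ->
  pop w (fun x => u (z0 + s *: x)) x = s ^+ 2 * pop w u (z0 + s *: x).
Proof.
move=> su; rewrite /pop big_distrr /=; apply: eq_bigr => i _.
rewrite dirD_scaling// mulrCA; congr (_ * _).
have s1 := smooth_dirD (e i) su.
have s2 : smooth (fun x => dirD (e i) u (z0 + s *: x)).
  apply: (smooth_affine (B := fun v => s *: v) s1); split.
    have c1 : continuous (fun x : V => s *: x) by exact: scaler_continuous.
    by move=> z; exact: (cvgD (cvg_cst _) (c1 z)).
  by move=> z v h; rewrite scalerDr addrCA !scalerA mulrC.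
transitivity (s * dirD (e i) (fun x => dirD (e i) u (z0 + s *: x)) x).
  by apply: dirD_val; apply: is_derive_scale; exact: smooth_is_derive.
by rewrite dirD_scaling// mulrA -expr2.
Qed.

(** Vanishes whenever P f = k f, whatever the constant k. *)
Definition wronskian w f x y : R := pop w f x * f y - pop w f y * f x.

Lemma localized_helm bc l lam u z0 : 0 < lam -> eigsp bc l lam u ->
  helm 1 (fun x => u (z0 + (Num.sqrt lam)^-1 *: x)).
Proof.
move=> lam0 /eigsp_helm Hu; have := helm_scaling (Num.sqrt lam)^-1 z0 Hu.
by rewrite exprVn sqr_sqrtr ?ltW// mulVf// gt_eqF.
Qed.

Lemma localized_wronskian bc (l w : 'I_d -> R) lam u z0 x y : (forall i, 0 < side l i) ->
  0 < lam -> (forall lam, exists mu, forall n : 'I_d -> nat,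
      \sum_i (pi * (n i)%:R / side l i) ^+ 2 = lam ->
      \sum_i w i * (pi * (n i)%:R / side l i) ^+ 2 = mu) ->
  eigsp bc l lam u ->
  wronskian w (fun x => u (z0 + (Num.sqrt lam)^-1 *: x)) x y = 0.
Proof.
move=> l0 lam0 spec Eu; have [mu muP] := spec lam.
have P := eigsp_pop l0 (ltW lam0) muP Eu.
rewrite /wronskian !(pop_scaling _ _ _ _ Eu.1) !P.
by move: (u _) (u _) (_ ^+ 2) => a1 a2 a3; ring.
Qed.

Lemma pop_lin lam w f g (a b : R) x : helm lam f -> helm lam g ->
  pop w (fun x => a * f x + b * g x) x = a * pop w f x + b * pop w g x.
Proof.
move=> Hf Hg; rewrite /pop !big_distrr -big_split /=; apply: eq_bigr => i _.
have -> : dirD (e i) (fun x => a * f x + b * g x) =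
    fun x => a * dirD (e i) f x + b * dirD (e i) g x.
  by apply/funext => y; exact: dirD_lin Hf.1 Hg.1.
rewrite (dirD_lin a b _ _ (smooth_dirD (e i) Hf.1) (smooth_dirD (e i) Hg.1)).
by rewrite mulrDr !(mulrCA (w i)).
Qed.

(** The gradient estimate for lambda = 1 at radius rho, applied twice; hence the square, and the
    radius 2 rho in [pop_small]. *)
Definition pop_const (w : 'I_d -> R) (rho : R) : R :=
  (\sum_i `|w i|) * (d%:R / rho + rho / 2) ^+ 2.

Lemma pop_small w g x (rho dl : R) : helm 1 g -> 0 < rho ->
  (forall z, cube x (rho + rho) z -> `|g z| <= dl) ->
  `|pop w g x| <= pop_const w rho * dl.
Proof.
move=> Hg rho0 gd; rewrite /pop /pop_const -mulrA big_distrl /=.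
apply: le_trans (ler_norm_sum _ _ _) _; apply: ler_sum => i _.
rewrite normrM ler_wpM2l// expr2 -mulrA.
have grad f c M : helm 1 f -> (forall y, cube c rho y -> `|f y| <= M) ->
    `|dirD (e i) f c| <= (d%:R / rho + rho / 2) * M.
  by move=> Hf fM; have := interior_gradient i Hf ler01 rho0 fM; rewrite mul1r.
apply: (grad _ _ _ (helm_dirD (e i) Hg)) => y xy.
apply: (grad _ _ _ Hg) => z yz; apply: gd => j.
have -> : z 0 j - x 0 j = (z 0 j - y 0 j) + (y 0 j - x 0 j) by rewrite addrA subrK.
by apply: le_trans (ler_normD _ _) _; apply: lerD.
Qed.

(* The Wronskian of the limit is controlled by the interior estimates applied
   to the difference. *)
Lemma wronskian_separation w phi x y (rho : R) : helm 1 phi -> 0 < rho ->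
  wronskian w phi x y != 0 ->
  exists2 dl0 : R, 0 < dl0 & forall (v : V -> R) (dl : R), helm 1 v -> wronskian w v x y = 0 ->
    (forall z, cube x (rho + rho) z \/ cube y (rho + rho) z -> `|phi z - v z| <= dl) ->
    dl0 <= dl.
Proof.
move=> Hp rho0 W0.
pose K := pop_const w rho + 1.
have K1 : 1 <= K.
  by rewrite lerDr mulr_ge0 ?sqr_ge0//; apply: sumr_ge0 => i _; exact: normr_ge0.
have K0 : 0 < K by apply: lt_le_trans K1.
pose S := `|pop w phi x| + `|phi y| + `|pop w phi y| + `|phi x|.
have S0 : 0 <= S by rewrite !addr_ge0.
(* If phi and v are dl-close, the difference of Wronskians is at most K dl S + 2 (K dl)^2, which for
   0 <= dl <= 1 is at most dl Q. *)
pose Q := K * S + 2 * K ^+ 2 + 1.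
have Q0 : 0 < Q by rewrite ltr_wpDl// addr_ge0// mulr_ge0 ?sqr_ge0// ltW.
exists (Num.min 1 (`|wronskian w phi x y| / Q)).
  by rewrite lt_min ltr01 divr_gt0// normr_gt0.
move=> v dl Hv Wv close; rewrite leNgt; apply/negP; rewrite lt_min => /andP[dl1 dlQ].
have r20 : 0 <= rho + rho by rewrite addr_ge0// ltW.
have cc (z : V) : cube z (rho + rho) z by move=> j; rewrite subrr normr0.
have dl0 : 0 <= dl := le_trans (normr_ge0 _) (close x (or_introl (cc x))).
have He := helm_lin 1 (-1) Hp Hv; set g := (fun x => _) in He.
have gE z : g z = phi z - v z by rewrite /g mul1r mulN1r.
have dK : dl <= K * dl by rewrite ler_peMl.
have pK z : `|pop w g z| <= pop_const w rho * dl -> `|pop w g z| <= K * dl.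
  by move=> /le_trans; apply; rewrite ler_wpM2r// lerDl.
have gx : `|g x| <= K * dl by apply: le_trans dK; rewrite gE close//; left.
have gy : `|g y| <= K * dl by apply: le_trans dK; rewrite gE close//; right.
have px : `|pop w g x| <= K * dl.
  by apply/pK/(pop_small _ He rho0) => z cz; rewrite gE close//; left.
have py : `|pop w g y| <= K * dl.
  by apply/pK/(pop_small _ He rho0) => z cz; rewrite gE close//; right.
have popg z : pop w g z = pop w phi z - pop w v z.
  by rewrite (pop_lin w 1 (-1) z Hp Hv) mul1r mulN1r.
clearbody g.
have E : wronskian w phi x y = pop w phi x * g y + pop w g x * phi y
   - pop w phi y * g x - pop w g y * phi x - (pop w g x * g y - pop w g y * g x).
  move: Wv; rewrite /wronskian !popg !gE.
  move: (pop w phi x) (pop w phi y) (pop w v x) (pop w v y) (phi x) (phi y) (v x) (v y).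
  move=> a1 a2 a3 a4 a5 a6 a7 a8 /eqP; rewrite subr_eq0 => /eqP W.
  apply/eqP; rewrite -subr_eq0; apply/eqP.
  transitivity (a3 * a8 - a4 * a7); first by ring.
  by rewrite W subrr.
have : `|wronskian w phi x y| <= K * dl * S + 2 * (K * dl) ^+ 2.
  rewrite E.
  have n1 (a b c : R) : `|b| <= c -> `|a * b| <= c * `|a|.
    by move=> bc; rewrite normrM mulrC ler_wpM2r.
  have n2 (a b c : R) : `|a| <= c -> `|b| <= c -> `|a * b| <= c ^+ 2.
    by move=> ac bc; rewrite normrM expr2 ler_pM.
  have m1 := n1 (pop w phi x) _ _ gy; have m2 := n1 (phi y) _ _ px.
  have m3 := n1 (pop w phi y) _ _ gx; have m4 := n1 (phi x) _ _ py.
  have m5 := n2 _ _ _ px gy; have m6 := n2 _ _ _ py gx.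
  rewrite [pop w g x * phi y]mulrC [pop w g y * phi x]mulrC.
  apply: le_trans (ler_normB _ _) _; apply: lerD.
    rewrite /S !mulrDr.
    apply: le_trans (ler_normB _ _) _; apply: lerD => //.
    apply: le_trans (ler_normB _ _) _; apply: lerD => //.
    by apply: le_trans (ler_normD _ _) _; apply: lerD.
  rewrite [2 * _]mulr_natl mulr2n.
  by apply: le_trans (ler_normB _ _) _; apply: lerD.
apply/negP; rewrite -ltNge; move: dlQ; rewrite ltr_pdivlMr// => dlQ.
apply: le_lt_trans dlQ.
rewrite /Q -subr_ge0; clearbody S K.
have -> : dl * (K * S + 2 * K ^+ 2 + 1) - (K * dl * S + 2 * (K * dl) ^+ 2) =
   dl * (2 * K ^+ 2) * (1 - dl) + dl by ring.
by rewrite addr_ge0// mulr_ge0 ?subr_ge0 ?(ltW dl1)// mulr_ge0// mulr_ge0 ?sqr_ge0.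
Qed.

End Separation.

(** * Decay of Bessel functions *)
Section BesselSeries.
Context {R : realType}.
Implicit Types (b s x : R) (k : nat).

(* (-1/4)^k / (k! b (b+1) .. (b+k-1)): the normalised Bessel function of order
   b - 1 is the sum of these coefficients times s^k at s = r^2. *)
Fixpoint bcoef b k : R :=
  if k is k'.+1 then bcoef b k' * - (4 * k'.+1%:R * (b + k'%:R))^-1 else 1.

Lemma bcoef0 b : bcoef b 0 = 1.
Proof. by []. Qed.

Lemma bcoefS b k : bcoef b k.+1 = bcoef b k * - (4 * k.+1%:R * (b + k%:R))^-1.
Proof. by []. Qed.

Arguments bcoef : simpl never.

Lemma nat_shift_neq0 b k : 1 <= b -> b + k%:R != 0.
Proof. by move=> b1; rewrite gt_eqF// ltr_wpDr// (lt_le_trans ltr01). Qed.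

(** Differentiation raises the parameter b by one, as for the hypergeometric series 0F1(; b;
    -s/4). *)
Lemma bcoef_diff b k : 1 <= b ->
  k.+1%:R * bcoef b k.+1 = - (4 * b)^-1 * bcoef (b + 1) k.
Proof.
move=> b1; have b0 : b != 0 by rewrite gt_eqF// (lt_le_trans ltr01).
elim: k => [|k IH]; first by rewrite bcoefS !bcoef0 addr0 !mul1r !mulr1.
have k1 : k.+1%:R != 0 :> R by rewrite pnatr_eq0.
have k2 : k.+2%:R != 0 :> R by rewrite pnatr_eq0.
have bk : b + k.+1%:R != 0 by exact: nat_shift_neq0.
have bk' : b + 1 + k%:R = b + k.+1%:R by rewrite -addrA nat1r.
rewrite [bcoef b k.+2]bcoefS [bcoef (b + 1) k.+1]bcoefS bk'.
have -> : bcoef b k.+1 = (- (4 * b)^-1 * bcoef (b + 1) k) / k.+1%:R.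
  by rewrite -IH mulrC mulKf.
move: k1 k2 bk; move: (k.+1%:R : R) (k.+2%:R : R) (bcoef _ _) => p q t p0 q0 bp.
by field; rewrite b0 p0 q0 bp.
Qed.

(** Since derivatives shift b, this three-term relation between b, b + 1 and b + 2 is the
    differential equation 4 s G'' + 4 b G' + G = 0 in disguise. *)
Lemma bcoef_contiguous b k : 1 <= b ->
  bcoef b k.+1 = bcoef (b + 1) k.+1 - (4 * b * (b + 1))^-1 * bcoef (b + 1 + 1) k.
Proof.
move=> b1; have b0 : b != 0 by rewrite gt_eqF// (lt_le_trans ltr01).
have b11 : 1 <= b + 1 by rewrite lerDr (le_trans ler01).
have b10 : b + 1 != 0 by rewrite gt_eqF// (lt_le_trans ltr01).
have k1 : k.+1%:R != 0 :> R by rewrite pnatr_eq0.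
have k2 : k.+2%:R != 0 :> R by rewrite pnatr_eq0.
have bk : b + k.+1%:R != 0 by exact: nat_shift_neq0.
have E1 := bcoef_diff k b11; have E2 := bcoef_diff k.+1 b1.
rewrite [bcoef b k.+2]bcoefS in E2.
have -> : bcoef (b + 1 + 1) k = - (4 * (b + 1)) * (k.+1%:R * bcoef (b + 1) k.+1).
  by rewrite E1 mulrA mulrNN mulfV ?mul1r// mulf_neq0.
have -> : bcoef (b + 1) k.+1 = - (4 * b) *
    (k.+2%:R * (bcoef b k.+1 * - (4 * k.+2%:R * (b + k.+1%:R))^-1)).
  by rewrite E2 mulrA mulrNN mulfV ?mul1r// mulf_neq0.
move: k2 bk; move: (k.+1%:R : R) (k.+2%:R : R) (bcoef _ _) => p q t q0 bp.
by field; rewrite b0 b10 q0 bp.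
Qed.

Lemma bcoef_le b k : 1 <= b -> `|bcoef b k| <= (k`!%:R)^-1.
Proof.
move=> b1; elim: k => [|k IH]; first by rewrite bcoef0 normr1 fact0 invr1.
have k0 : 0 < k.+1%:R :> R by rewrite ltr0n.
have k1 : 1 <= 4 * (b + k%:R) :> R.
  by have : 0 <= k%:R :> R by []; move: b1; lra.
rewrite bcoefS normrM normrN factS natrM [in leRHS]invfM [leRHS]mulrC ler_pM//.
rewrite ger0_norm; last by rewrite invr_ge0 !mulr_ge0// addr_ge0// (le_trans ler01).
rewrite lef_pV2 ?posrE//; last by rewrite mulrAC mulr_gt0// (lt_le_trans ltr01).
by rewrite mulrAC ler_peMl// ltW.
Qed.

Lemma cvg_bessel b x : 1 <= b -> cvgn (pseries (bcoef b) x).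
Proof.
move=> b1; apply: normed_cvg; apply: series_le_cvg (is_cvg_series_exp_coeff `|x|).
- by move=> n; exact: normr_ge0.
- by move=> n; rewrite /exp_coeff /= divr_ge0// exprn_ge0.
- move=> n; rewrite /exp_coeff /= normrM normrX mulrC ler_wpM2l ?exprn_ge0//.
  exact: bcoef_le.
Qed.

Arguments cvg_bessel [b] x _.

Definition bessel b s : R := limn (pseries (bcoef b) s).

Lemma pseries_scale (k x : R) (c : nat -> R) : cvgn (pseries c x) ->
  cvgn (pseries (fun i => k * c i) x) /\
  limn (pseries (fun i => k * c i) x) = k * limn (pseries c x).
Proof.
move=> cc.
have E : pseries (fun i => k * c i) x = series (k *: [sequence c i * x ^+ i]_i).
  by rewrite /pseries; congr series; apply/funext => i /=; rewrite -mulrA.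
rewrite E; split; first exact: is_cvg_seriesZ.
exact: lim_seriesZ.
Qed.

Lemma bcoef_diffs b : 1 <= b ->
  pseries_diffs (bcoef b) = fun i => - (4 * b)^-1 * bcoef (b + 1) i.
Proof. by move=> b1; apply/funext => i; rewrite /pseries_diffs bcoef_diff. Qed.

Lemma ge1_succ b : 1 <= b -> 1 <= b + 1.
Proof. by move=> b1; rewrite lerDr (le_trans ler01). Qed.

Lemma is_derive_bessel b s : 1 <= b ->
  is_derive s 1 (bessel b) (- (4 * b)^-1 * bessel (b + 1) s).
Proof.
move=> b1; have b2 := ge1_succ b1; have b3 := ge1_succ b2.
have [c1 l1] := pseries_scale (- (4 * b)^-1) (cvg_bessel s b2).
rewrite /bessel -l1 -(bcoef_diffs b1).
apply: (@pseries_snd_diffs _ _ (`|s| + 1)).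
- exact: cvg_bessel.
- rewrite bcoef_diffs//; exact: (pseries_scale _ (cvg_bessel _ b2)).1.
- rewrite bcoef_diffs//.
  have -> : pseries_diffs (fun i => - (4 * b)^-1 * bcoef (b + 1) i) =
     fun i => - (4 * b)^-1 * (- (4 * (b + 1))^-1 * bcoef (b + 1 + 1) i).
    by apply/funext => i; rewrite /pseries_diffs mulrCA bcoef_diff.
  exact: (pseries_scale _ (pseries_scale _ (cvg_bessel _ b3)).1).1.
- by rewrite [`|_ + 1|]ger0_norm ?addr_ge0// ltrDl.
Qed.

Lemma pseriesS (c : nat -> R) x n :
  pseries c x n.+1 = c 0%N + x * \sum_(0 <= i < n) c i.+1 * x ^+ i.
Proof.
rewrite /pseries /series /= big_nat_recl// expr0 mulr1 big_distrr /=; congr (_ + _).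
by apply: eq_bigr => i _; rewrite exprS mulrCA.
Qed.

Lemma bessel_contiguous b s : 1 <= b ->
  bessel b s = bessel (b + 1) s - (4 * b * (b + 1))^-1 * (s * bessel (b + 1 + 1) s).
Proof.
move=> b1; have b2 := ge1_succ b1; have b3 := ge1_succ b2.
have sh c : cvgn (pseries c s) -> pseries c s n.+1 @[n --> \oo] --> limn (pseries c s).
  by move=> cc; rewrite cvg_shiftS.
have c1 := sh _ (cvg_bessel s b1).
apply: (cvg_unique _ c1) => //.
have -> : (fun n => pseries (bcoef b) s n.+1) = (fun n => pseries (bcoef (b + 1)) s n.+1 -
     (4 * b * (b + 1))^-1 * (s * pseries (bcoef (b + 1 + 1)) s n)).
  apply/funext => n; rewrite !pseriesS !bcoef0 /pseries /series /= -addrA; congr (_ + _).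
  rewrite mulrCA -mulrBr; congr (_ * _); rewrite big_distrr -sumrB /=.
  by apply: eq_bigr => i _; rewrite (bcoef_contiguous i b1) mulrBl mulrA.
apply: cvgB; first exact: sh (cvg_bessel s b2).
by apply: cvgMl_tmp; apply: cvgMl_tmp; exact: cvg_bessel.
Qed.

Lemma bessel0 b : bessel b 0 = 1.
Proof.
apply/cvg_lim => //; rewrite -cvg_shiftS.
have -> : (fun n => pseries (bcoef b) 0 n.+1) = fun=> 1.
  by apply/funext => n; rewrite pseriesS mul0r addr0 bcoef0.
exact: cvg_cst.
Qed.

End BesselSeries.

(** * Energy estimate for the radial equation *)

Section RadialDecay.
Context {R : realType}.
Variables (n : nat) (G0 G1 G2 : R -> R).
Hypothesis dG0 : forall s : R, is_derive s 1 G0 (G1 s).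
Hypothesis dG1 : forall s : R, is_derive s 1 G1 (G2 s).
Hypothesis ode : forall s : R, 4 * s * G2 s + 2 * n.+2%:R * G1 s + G0 s = 0.

Let a : R := n.+1%:R / 2.
Let k : R := `|a ^+ 2 - a|.
Let F (r : R) := G0 (r * r).
(** For g = r^a F this is r^-a g'; the derivative of F is 2 r G1(r^2). *)
Let P (r : R) := 2 * (r * G1 (r * r)) + a * (r^-1 * F r).
Let E (r : R) := r ^+ n.+1 * (F r * F r + P r * P r).
(** Gronwall factor: |E'| <= k E/r^2 because 2 |F P| <= F^2 + P^2, and k/r has derivative -k/r^2, so
    Phi is nonincreasing. *)
Let Phi (r : R) := E r * expR (k * r^-1).

Lemma is_derive_sq (r : R) : is_derive r 1 (fun r : R => r * r) (r * 1 + 1 * r).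
Proof. exact: is_derive_mul. Qed.

Lemma is_derive_invr (r : R) : 0 < r -> is_derive r 1 (fun r : R => r^-1) (- (r ^- 2)).
Proof.
move=> r0; apply: DeriveDef.
  by apply: derivableV; [rewrite gt_eqF|exact: derivable_id].
have r1 : id r != 0 by rewrite gt_eqF.
have := @deriveV R R^o id r 1 r1 (@derivable_id _ _ _ _).
by rewrite derive_id [_ *: 1]mulr1.
Qed.

(* In terms of g = r^a f, with a = (d-1)/2, the radial equation reads
   g'' + g = (a^2 - a) g / r^2 and E is g^2 + g'^2. *)
Lemma is_derive_energy (r : R) : 0 < r ->
  is_derive r 1 E (2 * (a ^+ 2 - a) * r ^- 2 * r ^+ n.+1 * (F r * P r)).
Proof.
move=> r0; have rn : r != 0 by rewrite gt_eqF.
have dF : is_derive r 1 F (G1 (r * r) * (r * 1 + 1 * r)).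
  exact: (is_derive_chain (dG0 _) (is_derive_sq r)).
have dg : is_derive r 1 (fun r => G1 (r * r)) (G2 (r * r) * (r * 1 + 1 * r)).
  exact: (is_derive_chain (dG1 _) (is_derive_sq r)).
have dP : is_derive r 1 P (2 * (r * (G2 (r * r) * (r * 1 + 1 * r)) + 1 * G1 (r * r)) +
    a * (r^-1 * (G1 (r * r) * (r * 1 + 1 * r)) + - (r ^- 2) * F r)).
  apply: is_derive_add; apply: is_derive_scale; apply: is_derive_mul => //.
  exact: is_derive_invr.
have dpow : is_derive r 1 (fun r : R => r ^+ n.+1) (n.+1%:R * r ^+ n).
  by apply: DeriveDef; [exact: exprn_derivable|rewrite exp_derive [_ *: 1]mulr1].
have := is_derive_mul dpow (is_derive_add (is_derive_mul dF dF) (is_derive_mul dP dP)).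
set V := (X in is_derive _ _ _ X); suff -> : V = 2 * (a ^+ 2 - a) * r ^- 2 * r ^+ n.+1 * (F r * P r) by [].
rewrite /V /P /F exprS.
have -> : G2 (r * r) = - (2 * n.+2%:R * G1 (r * r) + G0 (r * r)) / (4 * (r * r)).
  have := ode (r * r); rewrite -addrA => /addr0_eq <-.
  by rewrite opprK [4 * _ * G2 _]mulrC mulfK// !mulf_neq0.
rewrite /a -(natr1 n.+1).
move: (G1 _) (G0 _) (r ^+ n) (n.+1%:R : R) => g1 g0 rp m.
by field.
Qed.

Lemma is_derive_Phi (r : R) : 0 < r ->
  exists2 V, is_derive r 1 Phi V & V <= 0.
Proof.
move=> r0; have rn : r != 0 by rewrite gt_eqF.
have dk : is_derive r 1 (fun r => expR (k * r^-1)) (expR (k * r^-1) * (k * - (r ^- 2))).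
  apply: (is_derive_chain (is_derive_expR _)).
  by apply: is_derive_scale; exact: is_derive_invr.
exists (E r * (expR (k * r^-1) * (k * - (r ^- 2))) +
  2 * (a ^+ 2 - a) * r ^- 2 * r ^+ n.+1 * (F r * P r) * expR (k * r^-1)).
  by apply: is_derive_mul => //; exact: is_derive_energy.
rewrite /E.
have -> : r ^+ n.+1 * (F r * F r + P r * P r) * (expR (k * r^-1) * (k * - (r ^- 2))) +
  2 * (a ^+ 2 - a) * r ^- 2 * r ^+ n.+1 * (F r * P r) * expR (k * r^-1) =
  expR (k * r^-1) * r ^- 2 * r ^+ n.+1 *
    (2 * (a ^+ 2 - a) * (F r * P r) - k * (F r * F r + P r * P r)).
  by move: (k) (F r) (P r) (r ^+ n.+1) (a ^+ 2 - a) (r ^- 2) (expR _) => *; ring.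
rewrite mulr_ge0_le0//.
  by rewrite !mulr_ge0 ?expR_ge0 ?invr_ge0 ?exprn_ge0// ltW.
rewrite subr_le0 /k; move: (a ^+ 2 - a) (F r) (P r) => q x y.
apply: le_trans (ler_norm _) _; rewrite !normrM ger0_norm//.
have sq (z : R) : z * z = `|z| * `|z| by rewrite -normrM ger0_norm// -expr2 sqr_ge0.
rewrite (sq x) (sq y) mulrAC mulrC.
move: (`|q|) (`|x|) (`|y|) (normr_ge0 q) => q' x' y' q0.
rewrite ler_wpM2l// -subr_ge0.
have -> : x' * x' + y' * y' - 2 * (x' * y') = (x' - y') ^+ 2 by ring.
exact: sqr_ge0.
Qed.

Lemma radial_decay : exists C : R, forall r : R, 0 <= r ->
  Num.max 1 r ^+ n.+1 * G0 (r * r) ^+ 2 <= C.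
Proof.
have cF : continuous F.
  by apply: derivable_continuous => r; case: (is_derive_chain (dG0 _) (is_derive_sq r)).
have c2 : continuous (fun r => F r * F r) := continuous_fmul cF cF.
have [t _ tP] := EVT_max (ler01 : 0 <= 1 :> R) (continuous_subspaceT c2).
exists (Num.max (F t * F t) (Phi 1)) => r r0; rewrite -/(F r) expr2 le_max.
have [r1|r1] := leP r 1.
  by rewrite expr1n mul1r tP// in_itv /= r0.
apply/orP; right.
have le1 : Phi r <= Phi 1.
  have D (x : R) : x \in `[1, r]%R -> exists2 V, is_derive x 1 Phi V & V <= 0.
    by rewrite in_itv /= => /andP[x1 _]; apply: is_derive_Phi; exact: lt_le_trans x1.
  have [| |x xin E1] := @MVT R Phi ('D_1 Phi) 1 r r1.
  - move=> x; rewrite in_itv /= => /andP[x1 xr].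
    have [|V dV _] := D x; first by rewrite in_itv /= !ltW.
    by apply: derivableP; case: dV.
  - apply: derivable_within_continuous => x xin.
    by have [V []] := D x xin.
  - have [|V dV V0] := D x; first by apply: subset_itv_oo_cc.
    have : 'D_1 Phi x = V by case: dV.
    move=> DV; rewrite -subr_le0 E1 DV mulr_le0_ge0// subr_ge0 ltW//.
apply: le_trans le1; have r0' : 0 < r := lt_trans ltr01 r1.
apply: (@le_trans _ _ (E r)).
  rewrite /E ler_wpM2l ?exprn_ge0// lerDl -expr2; exact: sqr_ge0.
rewrite /Phi ler_peMr//.
  by rewrite /E mulr_ge0 ?exprn_ge0// addr_ge0// -expr2 sqr_ge0.
apply: le_trans (expR_ge1Dx _); rewrite lerDl mulr_ge0 ?normr_ge0// invr_ge0 ltW//.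
Qed.

End RadialDecay.

(** * Radial waves and eigenfunctions *)
Section WeightedNorm.
Context {R : realType} {d : nat}.
Notation V := 'rV[R]_d.
Implicit Types (f g : V -> R) (z : V).

Lemma enorm_ge0 z : 0 <= enorm z.
Proof. exact: sqrtr_ge0. Qed.

Lemma sqnorm_ge0 z : 0 <= \sum_(i < d) z 0 i ^+ 2.
Proof. by apply: sumr_ge0 => i _; exact: sqr_ge0. Qed.

Lemma enorm_sq z : enorm z ^+ 2 = \sum_i z 0 i ^+ 2.
Proof. by rewrite sqr_sqrtr// sqnorm_ge0. Qed.

Lemma coord_le_enorm z i : `|z 0 i| <= enorm z.
Proof.
rewrite -sqrtr_sqr ler_sqrt ?sqnorm_ge0// (bigD1 i)//= lerDl.
by apply: sumr_ge0 => j _; exact: sqr_ge0.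
Qed.

Lemma enorm_le_sum z : enorm z <= \sum_i `|z 0 i|.
Proof.
have s0 : 0 <= \sum_i `|z 0 i| by apply: sumr_ge0.
rewrite -[leRHS]ger0_norm// -sqrtr_sqr ler_sqrt ?sqr_ge0//.
rewrite expr2 big_distrl /=; apply: ler_sum => i _.
rewrite -[z 0 i ^+ 2]real_normK ?num_real// expr2 ler_wpM2l//.
by rewrite (bigD1 i)//= lerDl; apply: sumr_ge0.
Qed.

Lemma MW_helm f : MW f <-> helm 1 f.
Proof. by split=> -[sf Hf]; split => // z; have := Hf z; rewrite mul1r. Qed.

Lemma MWs_helm f : MWs f -> helm 1 f.
Proof. by case=> /MW_helm. Qed.

Lemma MWs_lin f g (a b : R) : MWs f -> MWs g -> MWs (fun z => a * f z + b * g z).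
Proof.
move=> [/MW_helm Hf [C Cf]] [/MW_helm Hg [D Dg]]; split.
  by apply/MW_helm; exact: helm_lin.
exists (`|a| * C + `|b| * D) => z.
have p0 : 0 <= enorm z `^ wexp R d by exact: powR_ge0.
apply: (@le_trans _ _ (enorm z `^ wexp R d * (`|a| * `|f z| + `|b| * `|g z|))).
  by rewrite ler_wpM2l// -!normrM ler_normD.
by rewrite mulrDr; apply: lerD; rewrite mulrCA ler_wpM2l.
Qed.

Hypothesis d0 : (0 < d)%N.

Lemma wexp_ge0 : 0 <= wexp R d.
Proof. by rewrite divr_ge0// subr_ge0 ler1n. Qed.

(** Makes the [sup] in [wnorm] a genuine supremum. The weights |z| and 1 + |z| are comparable for
    |z| > 1; the unit ball is handled by continuity. *)
Lemma MWs_weight_bounded f : MWs f ->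
  has_ubound (range (fun z => (1 + enorm z) `^ wexp R d * `|f z|)).
Proof.
move=> [/MW_helm Hf [C Cf]].
have [M M0 MP] := continuous_bounded_cube 0 1 (smooth_continuous Hf.1).
have C0 : 0 <= C.
  by apply: le_trans (Cf 0); rewrite mulr_ge0 ?powR_ge0.
exists (2 `^ wexp R d * (M + C)) => _ [z _ <-].
have [z1|z1] := leP (enorm z) 1.
  apply: ler_pM; rewrite ?powR_ge0//.
    apply: ge0_ler_powR; rewrite ?wexp_ge0 ?nnegrE ?addr_ge0 ?enorm_ge0//.
    by rewrite -[2]/(1 + 1) lerD2l.
  apply: (@le_trans _ _ M); last by rewrite lerDl.
  apply: MP => j; rewrite mxE subr0; exact: le_trans (coord_le_enorm z j) z1.
apply: (@le_trans _ _ (2 `^ wexp R d * (enorm z `^ wexp R d * `|f z|))).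
  rewrite mulrA ler_wpM2r// -powRM ?enorm_ge0//.
  apply: ge0_ler_powR; rewrite ?wexp_ge0 ?nnegrE ?mulr_ge0 ?addr_ge0 ?enorm_ge0//.
  by rewrite mulr_natl mulr2n lerD2r ltW.
rewrite ler_wpM2l ?powR_ge0//; apply: le_trans (Cf z) _; by rewrite lerDr.
Qed.

Lemma weight_ge1 z : 1 <= (1 + enorm z) `^ wexp R d.
Proof.
have h1 : 1 <= 1 + enorm z by rewrite lerDl enorm_ge0.
by rewrite -[X in X <= _](powRr0 (1 + enorm z)); exact: (ler_powR h1 wexp_ge0).
Qed.

Lemma MWs_le_wnorm f z : MWs f -> `|f z| <= wnorm f.
Proof.
move=> mf; apply: (@le_trans _ _ ((1 + enorm z) `^ wexp R d * `|f z|)).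
  by rewrite ler_peMl// weight_ge1.
apply: ub_le_sup; first exact: MWs_weight_bounded.
by exists z.
Qed.

Lemma wnorm_scale f (t : R) : 0 <= t -> MWs f -> wnorm (fun z => t * f z) <= t * wnorm f.
Proof.
move=> t0 mf; apply: ge_sup; first by exists ((1 + enorm (0 : V)) `^ wexp R d * `|t * f 0|), 0.
move=> _ [z _ <-]; rewrite normrM (ger0_norm t0) mulrCA ler_wpM2l//.
apply: ub_le_sup; first exact: MWs_weight_bounded.
by exists z.
Qed.

Lemma wnorm_ge0 f : MWs f -> 0 <= wnorm f.
Proof. by move=> mf; apply: le_trans (MWs_le_wnorm 0 mf). Qed.

End WeightedNorm.

(** * The radial Bessel wave *)

Section RadialWave.
Context {R : realType} {d n : nat}.
Hypothesis dn : d = n.+2.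
Notation V := 'rV[R]_d.
Notation e := (@evec R d).
Implicit Types (x y z c : V) (i j : 'I_d).

Let b : R := d%:R / 2.

Lemma half_dim_ge1 : 1 <= b.
Proof. by rewrite /b ler_pdivlMr// mul1r dn -[2]/(2%:R) ler_nat. Qed.
Let b1 := half_dim_ge1.
Let b2 : 1 <= b + 1 := ge1_succ b1.
Let b3 : 1 <= b + 1 + 1 := ge1_succ b2.

Definition wave0 (s : R) : R := bessel b s.
Definition wave1 (s : R) : R := - (4 * b)^-1 * bessel (b + 1) s.
Definition wave2 (s : R) : R := - (4 * b)^-1 * (- (4 * (b + 1))^-1 * bessel (b + 1 + 1) s).

Lemma is_derive_wave0 (s : R) : is_derive s 1 wave0 (wave1 s).
Proof. exact: is_derive_bessel. Qed.

Lemma is_derive_wave1 (s : R) : is_derive s 1 wave1 (wave2 s).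
Proof. by apply: is_derive_scale; exact: is_derive_bessel. Qed.

Lemma continuous_wave2 : continuous wave2.
Proof.
have d2 (s : R) : is_derive s 1 wave2 (- (4 * b)^-1 * (- (4 * (b + 1))^-1 *
    (- (4 * (b + 1 + 1))^-1 * bessel (b + 1 + 1 + 1) s))).
  by do 2 apply: is_derive_scale; exact: is_derive_bessel.
exact: is_derive_continuous d2.
Qed.

Lemma wave_ode (s : R) : 4 * s * wave2 s + 2 * d%:R * wave1 s + wave0 s = 0.
Proof.
rewrite /wave0 bessel_contiguous// /wave1 /wave2.
have -> : d%:R = 2 * b by rewrite /b mulrC divfK.
have p1 : b != 0 by rewrite gt_eqF// (lt_le_trans ltr01).
have p2 : b + 1 != 0 by rewrite gt_eqF// (lt_le_trans ltr01).
clearbody b.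
move: (bessel _ s) (bessel _ s) => B1 B2.
by field; rewrite p1 p2.
Qed.

Definition sqn z : R := \sum_j z 0 j * z 0 j.

Lemma dirD_sqn i z : dirD (e i) sqn z = 2 * z 0 i.
Proof.
apply: dirD_val.
rewrite (_ : 2 * z 0 i = \sum_j (z 0 j * e i 0 j + e i 0 j * z 0 j)).
  by apply: is_derive_bigsum => j; apply: is_derive_mul; exact: is_derive_coord.
rewrite (bigD1 i)//= big1 => [|j ji].
  by rewrite evecE eqxx addr0 mulr1 mul1r -mulr2n mulr_natl.
by rewrite evecE eq_sym (negbTE ji) mulr0 mul0r addr0.
Qed.

Definition radial_wave c z : R := wave0 (sqn (z - c)).

Definition bessel_multiple (g : R -> R) :=
  exists k b' : R, 1 <= b' /\ g = fun s => k * bessel b' s.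

Lemma bessel_multiple_derive g : bessel_multiple g ->
  exists2 g', bessel_multiple g' & forall t : R, is_derive t 1 g (g' t).
Proof.
move=> [k [b' [b'1 ->]]]; exists (fun s => k * - (4 * b')^-1 * bessel (b' + 1) s).
  by exists (k * - (4 * b')^-1), (b' + 1); split; [exact: ge1_succ|].
by move=> t; rewrite -mulrA; apply: is_derive_scale; exact: is_derive_bessel.
Qed.

Lemma smooth_sqn_shift c : smooth (fun z => sqn (z - c)).
Proof. exact: (smooth_affine smooth_sqnorm (affine_shift (- c))). Qed.

Lemma smooth_radial g c : bessel_multiple g -> smooth (fun z => g (sqn (z - c))).
Proof. by move=> Gg; exact: smooth_comp bessel_multiple_derive _ _ (smooth_sqn_shift c) Gg. Qed.

Lemma wave0_multiple : bessel_multiple wave0.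
Proof. by exists 1, b; split => //; apply/funext => s; rewrite mul1r. Qed.

Lemma is_derive_sqn_shift c i z :
  is_derive z (e i) (fun z => sqn (z - c)) (2 * (z - c) 0 i).
Proof.
have := smooth_is_derive z (e i) (smooth_sqn_shift c).
rewrite (dirD_affine _ _ smooth_sqnorm (affine_shift (- c))).
by rewrite -/sqn dirD_sqn.
Qed.

Lemma dirD2_radial c i z : dirD (e i) (dirD (e i) (radial_wave c)) z =
  2 * wave1 (sqn (z - c)) + 4 * wave2 (sqn (z - c)) * ((z - c) 0 i * (z - c) 0 i).
Proof.
have -> : dirD (e i) (radial_wave c) = fun z => wave1 (sqn (z - c)) * (2 * (z - c) 0 i).
  apply/funext => y; apply: dirD_val.
  exact: (is_derive_chain (is_derive_wave0 _) (is_derive_sqn_shift c i y)).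
apply: dirD_val.
have D1 := is_derive_chain (is_derive_wave1 _) (is_derive_sqn_shift c i z).
have D2 : is_derive z (e i) (fun z => 2 * (z - c) 0 i) (2 * 1).
  apply: is_derive_scale.
  have -> : (fun y : V => (y - c) 0 i) = fun y => y 0 i - c 0 i.
    by apply/funext => y; rewrite !mxE.
  have := is_derive_sub (is_derive_coord i z (e i)) (is_derive_const (c 0 i) z (e i)).
  by rewrite evecE eqxx subr0.
have := is_derive_mul D1 D2; congr is_derive.
by move: (wave1 _) (wave2 _) ((z - c) 0 i) => *; ring.
Qed.

Lemma helm_radial c : helm 1 (radial_wave c).
Proof.
split; first exact: smooth_radial wave0_multiple.
move=> z; rewrite lapE (eq_bigr _ (fun i _ => dirD2_radial c i z)) big_split /=.
rewrite sumr_const card_ord -big_distrr /= -/(sqn (z - c)) mul1r.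
rewrite -[RHS](wave_ode (sqn (z - c))) /radial_wave; congr (_ + _).
rewrite -[_ *+ d]mulr_natl; move: (sqn _) => s.
by move: (wave1 s) (wave2 s) (d%:R : R) => *; ring.
Qed.

Lemma MWs_radial c : MWs (radial_wave c).
Proof.
split; first by apply/MW_helm; exact: helm_radial.
have ode s : 4 * s * wave2 s + 2 * n.+2%:R * wave1 s + wave0 s = 0.
  by rewrite -dn; exact: wave_ode.
have [C CP] := radial_decay is_derive_wave0 is_derive_wave1 ode.
(* Transfers decay away from c into decay away from the origin, through |z| <= A max(1, |z - c|). *)
pose A : R := d%:R + \sum_i `|c 0 i|.
have A0 : 0 <= A by rewrite addr_ge0// sumr_ge0.
exists (1 + A ^+ n.+1 * C) => z.
set r := enorm (z - c).
have r0 : 0 <= r := enorm_ge0 _.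
have rr : r * r = sqn (z - c) by rewrite -expr2 enorm_sq; apply: eq_bigr => i _; rewrite expr2.
have zA : enorm z <= A * Num.max 1 r.
  have m1 : 1 <= Num.max 1 r by rewrite le_max lexx.
  apply: le_trans (enorm_le_sum z) _; rewrite /A mulrDl; apply: (@le_trans _ _ (\sum_i (r + `|c 0 i|))).
    apply: ler_sum => i _; have := coord_le_enorm (z - c) i; rewrite -/r => zr.
    have -> : z 0 i = (z - c) 0 i + c 0 i by rewrite !mxE subrK.
    by apply: le_trans (ler_normD _ _) _; rewrite lerD2r.
  rewrite big_split /=; apply: lerD.
    by rewrite sumr_const card_ord -[r *+ d]mulr_natl ler_wpM2l// le_max lexx orbT.
  by rewrite ler_peMr// sumr_ge0.
set y := _ * _; have y0 : 0 <= y by rewrite mulr_ge0// powR_ge0.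
(* Squaring turns the exponent (d - 1)/2 into the natural power n + 1 of [radial_decay]; y <= 1 +
   y^2 comes back without a square root. *)
suff y2 : y ^+ 2 <= A ^+ n.+1 * C.
  apply: (@le_trans _ _ (1 + y ^+ 2)); last by rewrite lerD2l.
  rewrite -subr_ge0 (_ : _ - y = (y - 2^-1) ^+ 2 + 3 / 4); last by field.
  by rewrite addr_ge0 ?sqr_ge0.
have -> : y ^+ 2 = enorm z ^+ n.+1 * wave0 (r * r) ^+ 2.
  rewrite /y exprMn real_normK ?num_real// rr; congr (_ * _).
  rewrite -[LHS]powR_mulrn ?powR_ge0// -powRrM -powR_mulrn ?enorm_ge0//.
  by congr (_ `^ _); rewrite /wexp divfK// dn -natr1 addrK.
apply: (@le_trans _ _ ((A * Num.max 1 r) ^+ n.+1 * wave0 (r * r) ^+ 2)).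
  by rewrite ler_wpM2r ?sqr_ge0// lerXn2r// nnegrE ?enorm_ge0// (le_trans (enorm_ge0 z)).
by rewrite exprMn -mulrA ler_wpM2l ?exprn_ge0// CP.
Qed.

Lemma pop_radial w c i (t : R) : pop w (radial_wave c) (c + t *: e i) =
  2 * wave1 (t * t) * (\sum_k w k) + 4 * wave2 (t * t) * (t * t) * w i.
Proof.
have cE k : (c + t *: e i - c) 0 k = t * (i == k)%:R.
  by rewrite addrC addKr mxE evecE.
have qE : sqn (c + t *: e i - c) = t * t.
  rewrite /sqn (bigD1 i)//= big1 ?addr0 => [|k ki]; rewrite !cE.
    by rewrite eqxx mulr1.
  by rewrite eq_sym (negbTE ki) !mulr0.
rewrite /pop; under eq_bigr do rewrite dirD2_radial qE !cE mulrDr.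
rewrite big_split /= -big_distrl /=; congr (_ + _); first by rewrite mulrC.
rewrite (bigD1 i)//= big1 ?addr0 => [|k ki].
  by rewrite eqxx !mulr1 mulrC.
by rewrite eq_sym (negbTE ki) !mulr0.
Qed.

Lemma radial_value c i (t : R) : radial_wave c (c + t *: e i) = wave0 (t * t).
Proof.
rewrite /radial_wave; congr wave0; rewrite /sqn (bigD1 i)//= big1 ?addr0 => [|k ki].
  by rewrite addrC addKr mxE evecE eqxx mulr1.
by rewrite addrC addKr mxE evecE eq_sym (negbTE ki) !mulr0.
Qed.

(* The two points are at the same distance from c, so only the non-radial part
   4 w_i x_i^2 G''(|x|^2) of the operator survives in the Wronskian. *)
Lemma wronskian_radial w c i j : w i != 0 -> w j = 0 ->
  exists2 t0 : R, 0 < t0 & forall t, 0 < t -> t < t0 ->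
    wronskian w (radial_wave c) (c + t *: e i) (c + t *: e j) != 0.
Proof.
move=> wi wj.
pose f (t : R) := wave0 (t * t) * wave2 (t * t).
have csq : continuous (fun t : R => t * t) by exact: (is_derive_continuous (@is_derive_sq R)).
have cf : continuous f.
  apply: continuous_fmul => t.
    apply: (@continuous_comp _ _ _ (fun t : R => t * t) wave0); first exact: csq.
    exact: (is_derive_continuous is_derive_wave0).
  apply: (@continuous_comp _ _ _ (fun t : R => t * t) wave2); first exact: csq.
  exact: continuous_wave2.
have b0 : 0 < b := lt_le_trans ltr01 b1.
have f0 : 0 < f 0.
  rewrite /f mulr0 /wave0 /wave2 !bessel0 mul1r mulr1 mulrNN mulr_gt0// invr_gt0 mulr_gt0//.
  by rewrite addr_gt0.
have /cvgrPdist_lt/(_ _ f0)/nbhs_ballP[r /= r0 rP] := cf 0.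
exists r => // t t0 tr.
have : f t != 0.
  have /rP : ball (0 : R) r t by rewrite -ball_normE /= sub0r normrN gtr0_norm.
  by move=> ft; apply/eqP => E; move: ft; rewrite E subr0 gtr0_norm// ltxx.
rewrite /f mulf_eq0 negb_or => /andP[w0 w2].
rewrite /wronskian !pop_radial !radial_value wj mulr0 addr0 -mulrBl addrAC subrr add0r.
have tn : t != 0 by rewrite gt_eqF.
have n4 : 4 != 0 :> R by rewrite pnatr_eq0.
exact: (mulf_neq0 (mulf_neq0 (mulf_neq0 (mulf_neq0 n4 w2) (mulf_neq0 tn tn)) wi) w0).
Qed.

End RadialWave.

(** * Existence of an eigenfunction *)

Section Eigenfunctions.
Context {R : realType} {d : nat}.
Notation V := 'rV[R]_d.
Notation e := (@evec R d).
Implicit Types (x : V) (i j : 'I_d).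

Definition trig (g : R -> R) :=
  exists k1 k2 om : R, g = fun t => k1 * sin (om * t) + k2 * cos (om * t).

Lemma trig_derive g : trig g ->
  exists2 g', trig g' & forall t : R, is_derive t 1 g (g' t).
Proof.
move=> [k1 [k2 [om ->]]].
exists (fun t => - (k2 * om) * sin (om * t) + k1 * om * cos (om * t)).
  by exists (- (k2 * om)), (k1 * om), om.
move=> t; have dom : is_derive t 1 (fun t : R => om * t) (om * 1).
  exact: is_derive_scale (is_derive_id _ _).
have := is_derive_lin k1 k2 (is_derive_chain (is_derive_sin _) dom)
  (is_derive_chain (is_derive_cos _) dom).
by congr is_derive; move: (sin _) (cos _) => *; ring.
Qed.

Definition sepprod (T : 'I_d -> R -> R) x : R := \prod_j T j (x 0 j).

Lemma smooth_prod {I : Type} (r : seq I) (f : I -> V -> R) :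
  (forall i : I, smooth (f i)) -> smooth (fun x => \prod_(i <- r) f i x).
Proof.
move=> sf; elim: r => [|i r IH].
  by under eq_fun do rewrite big_nil; exact: smooth_const.
under eq_fun do rewrite big_cons; exact: smooth_mul (sf i) IH.
Qed.

Lemma smooth_sepprod T : (forall j, trig (T j)) -> smooth (sepprod T).
Proof.
move=> TT; apply: smooth_prod => j.
exact: smooth_comp trig_derive _ _ (smooth_coord j) (TT j).
Qed.

Definition upd (T : 'I_d -> R -> R) i g := fun j => if j == i then g else T j.

Lemma dirD_sepprod T i g x : (forall j, trig (T j)) ->
  (forall t : R, is_derive t 1 (T i) (g t)) ->
  dirD (e i) (sepprod T) x = sepprod (upd T i g) x.
Proof.
move=> TT dT.
have := is_derive_line x (e i) 0 (smooth_sepprod TT); rewrite scale0r addr0 => D.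
pose K := \prod_(j | j != i) T j (x 0 j).
have E : (fun s : R => sepprod T (x + s *: e i)) = fun s => K * T i (x 0 i + s).
  apply/funext => s; rewrite /sepprod (bigD1 i)//= mulrC; congr (_ * _).
    by apply: eq_bigr => j ji; rewrite !mxE (negbTE ji) andbF mulr0 addr0.
  by rewrite !mxE !eqxx mulr1.
rewrite E in D; apply: (is_derive_unique D).
rewrite /sepprod (bigD1 i)//= {1}/upd eqxx mulrC.
rewrite (eq_bigr (fun j => T j (x 0 j))) => [|j ji]; last by rewrite /upd (negbTE ji).
apply: is_derive_scale.
have ds : is_derive (0 : R) 1 (fun s : R => x 0 i + s) (0 + 1).
  exact: (is_derive_add (is_derive_const (x 0 i) _ _) (is_derive_id _ _)).
have dTi : is_derive (x 0 i + 0) 1 (T i) (g (x 0 i)) by rewrite addr0; exact: dT.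
by have := is_derive_chain dTi ds; rewrite add0r mulr1.
Qed.

Definition ground (bc : BC) (om : 'I_d -> R) j (t : R) : R :=
  match bc with Dirichlet => sin (om j * t) | Neumann => cos (om j * t) end.

Definition ground' (bc : BC) (om : 'I_d -> R) j (t : R) : R :=
  match bc with Dirichlet => om j * cos (om j * t) | Neumann => - om j * sin (om j * t) end.

Lemma is_derive_ground bc om j (t : R) :
  is_derive t 1 (ground bc om j) (ground' bc om j t) /\
  is_derive t 1 (ground' bc om j) (- om j ^+ 2 * ground bc om j t).
Proof.
have dom : is_derive t 1 (fun t : R => om j * t) (om j * 1).
  exact: is_derive_scale (is_derive_id _ _).
have ds := is_derive_chain (is_derive_sin _) dom.
have dc := is_derive_chain (is_derive_cos _) dom.
rewrite mulr1 in ds dc; case: bc => /=; split.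
- by rewrite mulrC.
- have := is_derive_scale (om j) dc; congr is_derive; move: (sin _) => *; ring.
- by move: dc; congr is_derive; move: (sin _) => *; ring.
- have := is_derive_scale (- om j) ds; congr is_derive; move: (cos _) => *; ring.
Qed.

Lemma ground_trig bc om j : trig (ground bc om j) /\ trig (ground' bc om j).
Proof.
case: bc; split.
- by exists 1, 0, (om j); apply/funext => t; rewrite /= mul1r mul0r addr0.
- by exists 0, (om j), (om j); apply/funext => t; rewrite /= mul0r add0r.
- by exists 0, 1, (om j); apply/funext => t; rewrite /= mul1r mul0r add0r.
- by exists (- om j), 0, (om j); apply/funext => t; rewrite /= mul0r addr0.
Qed.

(** The infimum of an empty set is 0 by convention, so positivity in [Nset] needs at least one
    eigenfunction. In the Neumann case it is a product of cosines rather than a constant, because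
    [Lam] asks for 0 < lam. *)
Lemma Lam_nonempty bc (l : 'I_d -> R) : (0 < d)%N -> (forall i, 0 < side l i) ->
  exists lam u, Lam bc l lam /\ eigsp bc l lam u.
Proof.
move=> d0 l0.
pose om i := pi / side l i.
have om0 i : 0 < om i by rewrite divr_gt0// pi_gt0.
pose T := ground bc om; pose u := sepprod T.
have TT j : trig (T j) := (ground_trig bc om j).1.
have su : smooth u := smooth_sepprod TT.
have D1 i : dirD (e i) u = sepprod (upd T i (ground' bc om i)).
  by apply/funext => x; apply: dirD_sepprod => // t; exact: (is_derive_ground bc om i t).1.
have TU i j : trig (upd T i (ground' bc om i) j).
  rewrite /upd; case: (j == i) => //; exact: (ground_trig bc om i).2.
have D2 i x : dirD (e i) (dirD (e i) u) x = - om i ^+ 2 * u x.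
  have dd (t : R) : is_derive t 1 (upd T i (ground' bc om i) i) (- om i ^+ 2 * T i t).
    by rewrite /upd eqxx; exact: (is_derive_ground bc om i t).2.
  rewrite D1 (dirD_sepprod x (TU i) dd).
  rewrite /u /sepprod (bigD1 i)//= [in RHS](bigD1 i)//= {1}/upd eqxx -mulrA.
  congr (_ * (_ * _)); apply: eq_bigr => j ji.
  by rewrite /upd (negbTE ji).
have zero T' i x : T' i (x 0 i) = 0 -> sepprod T' x = 0.
  by move=> E; rewrite /sepprod (bigD1 i)//= E mul0r.
pose lam := \sum_i om i ^+ 2.
have Eu : eigsp bc l lam u.
  split => //; split.
    move=> x; rewrite lapE (eq_bigr _ (fun i _ => D2 i x)) /lam big_distrl -big_split /=.
    by rewrite big1// => i _; rewrite mulNr addNr.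
  move=> i x [xi _].
  have sz : sin (om i * x 0 i) = 0.
    case: xi => ->; first by rewrite mulr0 sin0.
    by rewrite /om divfK ?gt_eqF// sinpi.
  have := D1 i; rewrite dirD.unlock => D1'.
  case E : bc.
    by apply: (zero _ i); rewrite /T E /=.
  have /(congr1 (fun f => f x)) /= -> := D1'.
  by apply: (zero _ i); rewrite /upd eqxx E /= sz mulr0.
have lam0 : 0 < lam.
  rewrite /lam (bigD1 (Ordinal d0))//= ltr_pwDl ?exprn_gt0//.
  by apply: sumr_ge0 => i _; exact: sqr_ge0.
exists lam, u; split => //; split => //; exists u; split => // uz.
pose x : V := match bc with Dirichlet => \row_i (side l i / 2) | Neumann => 0 end.
have : u x = 1.
  rewrite /u /sepprod big1// => i _; rewrite /T /x /om.
  case: (bc) => /=; last by rewrite mxE mulr0 cos0.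
  rewrite mxE (_ : _ * _ = pi / 2) ?sin_pihalf//.
  by rewrite mulrA divfK// gt_eqF.
by rewrite uz => /eqP; rewrite eq_sym oner_eq0.
Qed.

End Eigenfunctions.

(** * Failure of inverse localization *)
Section Localization.
Context {R : realType} {d : nat}.
Notation V := 'rV[R]_d.
Notation e := (@evec R d).
Implicit Types (phi psi u v : V -> R) (x y z c : V) (i j : 'I_d) (lam r : R).

Lemma eball_cube c r z : eball c r z -> cube c r z.
Proof.
move=> zc j; have := coord_le_enorm (z - c) j; rewrite !mxE => /le_trans; apply.
exact: ltW.
Qed.

(** Rests on |z - c| <= sum_i |z_i - x_i| + |x - c|, obtained by squaring: bounding each |x_i - c_i|
    by |x - c| in the cross terms avoids the Cauchy-Schwarz inequality. *)
Lemma cube_eball c r x (rho : R) z : cube x rho z ->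
  d%:R * rho + enorm (x - c) < r -> eball c r z.
Proof.
move=> xz; apply: le_lt_trans; rewrite /eball /=.
have s0 : 0 <= d%:R * rho + enorm (x - c).
  rewrite addr_ge0 ?enorm_ge0//.
  case: (posnP d) => [->|d0]; first by rewrite mul0r.
  by rewrite mulr_ge0//; apply: le_trans (xz (Ordinal d0)).
have tri : enorm (z - c) <= \sum_i `|(z - x) 0 i| + enorm (x - c).
  rewrite -[leRHS]ger0_norm; last by rewrite addr_ge0 ?enorm_ge0// sumr_ge0.
  rewrite -sqrtr_sqr ler_sqrt ?sqr_ge0//.
  set S := \sum_i `|_|; rewrite sqrrD enorm_sq.
  have S0 : 0 <= S by apply: sumr_ge0.
  apply: (@le_trans _ _ (\sum_i ((z - x) 0 i ^+ 2 + (`|(z - x) 0 i| * enorm (x - c)) *+ 2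
       + (x - c) 0 i ^+ 2))).
    apply: ler_sum => i _.
    have -> : (z - c) 0 i = (z - x) 0 i + (x - c) 0 i by rewrite !mxE addrA subrK.
    rewrite sqrrD lerD2r lerD2l lerMn2r /=.
    apply: le_trans (ler_norm _) _; rewrite normrM ler_wpM2l//.
    exact: coord_le_enorm.
  rewrite !big_split /= lerD2r; apply: lerD.
    rewrite expr2 /S big_distrl /=; apply: ler_sum => i _.
    rewrite -[(z - x) 0 i ^+ 2]real_normK ?num_real// expr2 ler_wpM2l//.
    by rewrite (bigD1 i)//= lerDl; apply: sumr_ge0.
  by rewrite mulr2n -big_distrl.
apply: (le_trans tri); rewrite lerD2r.
apply: (@le_trans _ _ (\sum_(i < d) rho)).
  by apply: ler_sum => i _; have := xz i; rewrite !mxE.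
by rewrite sumr_const card_ord mulr_natl.
Qed.

Definition localize u z0 lam : V -> R := fun x => u (z0 + (Num.sqrt lam)^-1 *: x).

Lemma C0dist_bounded c r phi bc l z0 lam u : helm 1 phi -> 0 < lam -> eigsp bc l lam u ->
  has_ubound [set `|phi x - localize u z0 lam x| | x in eball c r].
Proof.
move=> Hp lam0 Eu; have Hv := localized_helm z0 lam0 Eu.
have [M _ MP] := continuous_bounded_cube c r (smooth_continuous (helm_sub Hp Hv).1).
by exists M => _ [x /eball_cube cx <-]; exact: MP.
Qed.

Lemma le_C0dist c r phi bc l z0 lam u x : helm 1 phi -> 0 < lam -> eigsp bc l lam u ->
  eball c r x -> `|phi x - localize u z0 lam x| <= C0dist (eball c r) phi z0 lam u.
Proof.
move=> Hp lam0 Eu xB; apply: ub_le_sup; first exact: C0dist_bounded Hp lam0 Eu.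
by exists x.
Qed.

Definition distances bc l (B : set V) phi : set R :=
  [set s | exists z0 lam u,
     [/\ inQ l z0, Lam bc l lam, eigsp bc l lam u & s = C0dist B phi z0 lam u]].

Lemma distances_nonempty bc l B phi : (0 < d)%N -> (forall i, 0 < side l i) ->
  distances bc l B phi !=set0.
Proof.
move=> d0 l0; have [lam [u [Llam Eu]]] := Lam_nonempty bc d0 l0.
exists (C0dist B phi (\row_i (side l i / 2)) lam u), (\row_i (side l i / 2)), lam, u.
split => // i; rewrite mxE divr_gt0//= ltr_pdivrMr// ltr_pMr// ltr1n.
exact: isT.
Qed.

Lemma Nset_wronskian bc (l w : 'I_d -> R) c r phi x y (rho : R) : (0 < d)%N ->
  (forall i, 0 < side l i) ->
  (forall lam, exists mu, forall n : 'I_d -> nat,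
      \sum_i (pi * (n i)%:R / side l i) ^+ 2 = lam ->
      \sum_i w i * (pi * (n i)%:R / side l i) ^+ 2 = mu) ->
  MWs phi -> 0 < rho ->
  (forall z, cube x (rho + rho) z \/ cube y (rho + rho) z -> eball c r z) ->
  wronskian w phi x y != 0 -> Nset bc l (eball c r) phi.
Proof.
move=> d0 l0 spec mp rho0 sub W0; have Hp := MWs_helm mp; split => //.
have [dl0 dl00 sep] := wronskian_separation Hp rho0 W0.
apply: (lt_le_trans dl00); apply: lb_le_inf; first exact: distances_nonempty.
move=> _ [z0 [lam [u [_ [lam0 _] Eu ->]]]].
apply: (sep _ _ (localized_helm z0 lam0 Eu)).
  exact: (localized_wronskian z0 x y l0 lam0 spec Eu).
by move=> z /sub zB; exact: le_C0dist Hp lam0 Eu zB.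
Qed.

(** [C0dist] is 1-Lipschitz in phi for the uniform norm, which [wnorm] dominates; a perturbation
    below half the infimum leaves the other half. *)
Lemma Nset_open bc l c r phi : (0 < d)%N -> (forall i, 0 < side l i) -> 0 < r ->
  Nset bc l (eball c r) phi -> exists2 eps : R, 0 < eps &
     forall psi, MWs psi -> wnorm (fun z => psi z - phi z) < eps ->
       Nset bc l (eball c r) psi.
Proof.
move=> d0 l0 r0 [mp]; set I := inf _ => I0; have Hp := MWs_helm mp.
exists (I / 2); first by rewrite divr_gt0.
move=> psi ms close; have Hs := MWs_helm ms; split => //.
have md : MWs (fun z => psi z - phi z).
  have := MWs_lin 1 (-1) ms mp; congr MWs.
  by apply/funext => z; rewrite mul1r mulN1r.
have dist z : `|psi z - phi z| <= I / 2.
  exact: le_trans (MWs_le_wnorm d0 z md) (ltW close).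
apply: (@lt_le_trans _ _ (I / 2)); first by rewrite divr_gt0.
apply: lb_le_inf; first exact: distances_nonempty.
move=> _ [z0 [lam [u [zQ Ll Eu ->]]]]; have [lam0 _] := Ll.
have I1 : I <= C0dist (eball c r) phi z0 lam u.
  apply: ge_inf; last by exists z0, lam, u.
  (* The infimum is a lower bound only for a set bounded below; each distance dominates a value at
     the centre, hence is nonnegative. *)
  exists 0 => _ [z1 [lam1 [u1 [_ [lam10 _] Eu1 ->]]]].
  have cB : eball c r c by rewrite /eball /= subrr /enorm big1 ?sqrtr0// => i _; rewrite mxE expr0n.
  exact: le_trans (le_C0dist z1 Hp lam10 Eu1 cB).
have I2 : C0dist (eball c r) phi z0 lam u <= C0dist (eball c r) psi z0 lam u + I / 2.
  apply: ge_sup.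
    exists `|phi c - localize u z0 lam c|, c => //.
    by rewrite /eball /= subrr /enorm big1 ?sqrtr0// => i _; rewrite mxE expr0n.
  move=> _ [x xB <-]; have := le_C0dist z0 Hs lam0 Eu xB.
  rewrite /localize => h1.
  apply: (@le_trans _ _ (`|psi x - u (z0 + (Num.sqrt lam)^-1 *: x)| + `|phi x - psi x|)).
    by rewrite [leRHS]addrC; exact: (ler_distD (psi x)).
  by apply: lerD => //; rewrite distrC.
rewrite -(lerD2r (I / 2)) -splitr; exact: le_trans I2.
Qed.

(** The second difference over s, 2s, 3s equals 2 ga s^2, so the three values cannot all vanish. *)
Lemma quadratic_nonroot (al be ga s : R) : ga != 0 -> 0 < s ->
  exists2 t : R, 0 < t <= 3 * s & al + be * t + ga * t ^+ 2 != 0.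
Proof.
move=> ga0 s0.
have [E1|] := eqVneq (al + be * s + ga * s ^+ 2) 0; last first.
  by exists s => //; rewrite s0; move: s0; lra.
have [E2|] := eqVneq (al + be * (2 * s) + ga * (2 * s) ^+ 2) 0; last first.
  by exists (2 * s) => //; move: s0; lra.
exists (3 * s); first by rewrite lexx andbT; move: s0; lra.
apply/eqP => E3; move/eqP: ga0; apply.
have s2 : s ^+ 2 != 0 by rewrite expf_neq0// gt_eqF.
apply: (mulIf s2); apply: (mulfI (x := 2)); first by rewrite pnatr_eq0.
transitivity ((al + be * (3 * s) + ga * (3 * s) ^+ 2)
   - 2 * (al + be * (2 * s) + ga * (2 * s) ^+ 2) + (al + be * s + ga * s ^+ 2)).
  by ring.
by rewrite E1 E2 E3 mul0r !mulr0 subr0 addr0.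
Qed.

Lemma wronskian_pencil w phi psi x y (t : R) : helm 1 phi -> helm 1 psi ->
  wronskian w (fun z => 1 * phi z + t * psi z) x y = wronskian w phi x y +
    (pop w phi x * psi y + pop w psi x * phi y - pop w phi y * psi x - pop w psi y * phi x) * t
    + wronskian w psi x y * t ^+ 2.
Proof.
move=> Hp Hs; rewrite /wronskian !(pop_lin w 1 t _ Hp Hs).
by move: (pop w phi x) (pop w phi y) (pop w psi x) (pop w psi y) => *; ring.
Qed.

End Localization.

Unset Implicit Arguments.

Theorem theorem5p4 (R : realType) (d : nat) (hd : (2 <= d)%N)
  (l : 'I_d -> R)
  (hl : forall i : 'I_d, (val i < d.-1)%N -> 0 < l i)
  (hirr : exists j : 'I_d, (val j < d.-1)%N /\ l j ^+ 2 \in @irrational R)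
  (c : 'rV[R]_d) (r : R) (hr : 0 < r) (bc : BC) :
  let N := Nset bc l (eball c r) in
  (* N is open in MW^s *)
  (forall phi, N phi -> exists2 eps : R, 0 < eps &
     forall psi, MWs psi -> wnorm (fun z => psi z - phi z) < eps -> N psi) /\
  (* N is dense in MW^s *)
  (forall phi, MWs phi -> forall eps : R, 0 < eps ->
     exists psi, N psi /\ wnorm (fun z => psi z - phi z) < eps).
Proof.
move=> N; have d0 : (0 < d)%N by apply: leq_trans hd.
have l0 i : 0 < side l i.
  rewrite /side; case: eqVneq => // ne; apply: hl.
  by rewrite ltn_neqAle ne /= -ltnS prednK.
split=> [phi Np|phi mp eps eps0]; first exact: Nset_open Np.
have [j [jd jirr]] := hirr.
have dl : (d.-1 < d)%N by rewrite prednK.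
pose il := Ordinal dl.
have [w [w0 wj spec]] := separating_weights l0 jd jirr (erefl : val il = d.-1).
have dn : d = (d - 2).+2 by rewrite -addn2 subnK.
have [t0 t00 tP] := wronskian_radial dn c wj w0.
(* Below t0 for the Wronskian of the radial wave, and at most r/4 to keep x and y well inside the
   ball. *)
pose t := Num.min t0 r / 4.
have m0 : 0 < Num.min t0 r by rewrite lt_min t00 hr.
have t1 : 0 < t by rewrite divr_gt0.
have tt0 : t < t0.
  rewrite /t ltr_pdivrMr//; apply: (@le_lt_trans _ _ t0); first by rewrite ge_min lexx.
  by rewrite ltr_pMr// ltr1n.
have tr : t <= r / 4 by rewrite ler_wpM2r// ge_min lexx orbT.
have Wpsi := tP t t1 tt0.
pose psi := radial_wave c; have ms : MWs psi := MWs_radial dn c.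
have Hp := MWs_helm mp; have Hs := MWs_helm ms.
(* The coefficient q is at most 3 s, so q [wnorm psi] stays below 3 eps/4; the 1 guards against
   division by zero. *)
pose s := eps / (4 * (wnorm psi + 1)).
have n0 : 0 <= wnorm psi := wnorm_ge0 d0 ms.
have s0 : 0 < s by rewrite divr_gt0// mulr_gt0// ltr_wpDl.
set x := c + t *: evec R j in Wpsi; set y := c + t *: evec R il in Wpsi.
have [q /andP[q0 qs] nz] := quadratic_nonroot (wronskian w phi x y)
  (pop w phi x * psi y + pop w psi x * phi y - pop w phi y * psi x - pop w psi y * phi x)
  Wpsi s0.
rewrite -(wronskian_pencil w x y q Hp Hs) in nz.
exists (fun z => 1 * phi z + q * psi z); split; last first.
  have -> : (fun z => 1 * phi z + q * psi z - phi z) = fun z => q * psi z.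
    by apply/funext => z; rewrite mul1r addrC addKr.
  apply: le_lt_trans (wnorm_scale d0 (ltW q0) ms) _.
  apply: (@le_lt_trans _ _ (3 * s * wnorm psi)); first by rewrite ler_wpM2r.
  rewrite /s mulrA mulrAC ltr_pdivrMr; last by rewrite mulr_gt0// ltr_wpDl.
  rewrite [3 * eps]mulrC -mulrA ltr_pM2l//; move: n0; lra.
(* Chosen so that d (2 rho) = r/4: the cubes around x and y then stay within r/2 of c. *)
pose rho := r / (8 * d%:R).
have dR : 0 < d%:R :> R by rewrite ltr0n.
have rho0 : 0 < rho by rewrite divr_gt0// mulr_gt0.
have near k z : cube (c + t *: evec R k) (rho + rho) z -> eball c r z.
  move=> zc; apply: (cube_eball zc).
  have -> : enorm (c + t *: evec R k - c) = t.
    rewrite addrC addKr /enorm (bigD1 k)//= big1 ?addr0 => [|i ik].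
      by rewrite mxE evecE eqxx mulr1 sqrtr_sqr gtr0_norm.
    by rewrite mxE evecE eq_sym (negbTE ik) mulr0 expr0n.
  have -> : d%:R * (rho + rho) = r / 4 by rewrite /rho; field; rewrite gt_eqF.
  by move: tr hr; lra.
have sub z : cube x (rho + rho) z \/ cube y (rho + rho) z -> eball c r z.
  by case=> /near.
exact: (Nset_wronskian bc d0 l0 spec (MWs_lin 1 q mp ms) rho0 sub nz).
Qed.
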